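(* Let $\nu>0$ and consider on the circle $x\in[-\pi,\pi]$ (periodic boundary conditions) the equation $\omega_t=\omega\,\mathcal{H}(\omega)-\nu\,\omega$ for zero-mean $\omega$. Let $v_c(0)>0$ and $\omega_{-1}(0)\neq0$ be real, let $v_c(t)$ be given by $$v_c(t)=\frac{\omega_{-1}(0)(1-e^{-\nu t})+\nu v_c(0)(1+v_c(0))}{-\omega_{-1}(0)(1-e^{-\nu t})+\nu(1+v_c(0))}$$ and let $\omega_{-1}(t)=\frac{d v_c}{dt}(t)$. Then, as long as $0<v_c(t)<\infty$, $\omega=\omega_-+\omega_+$ with $$\omega_-(x,t)=\omega_{-1}(t)\left[\frac{1}{\tan(\frac x2)-iv_c(t)}-\frac{1}{-i-iv_c(t)}\right],\qquad \omega_+(x,t)=\overline{\omega_-(\bar x,t)},$$ is an exact real-valued, zero-mean solution, with $$\|\omega\|_{L^\infty}=\frac{|\omega_{-1}(t)|}{v_c(t)},\quad \|\omega\|_{L^2}=\frac{2\sqrt\pi\,|\omega_{-1}(t)|}{\sqrt{v_c(t)}\,(1+v_c(t))},\quad \|\omega\|_{B_0}=\frac{|\omega_{-1}(t)|}{v_c(t)}\left(\frac{|1-v_c(t)|}{1+v_c(t)}+1\right),$$ and: (a) if $-\nu v_c(0)(1+v_c(0))<\omega_{-1}(0)<\nu(1+v_c(0))$, then $0<v_c(t)<\infty$ for all $t>0$ and the solution exists for all $t>0$; (b1) if $\omega_{-1}(0)=-\nu v_c(0)(1+v_c(0))$, the solution exists for all $t>0$, and $\omega_{-1}(t),v_c(t)\to0$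 like $e^{-\nu t}$ as $t\to\infty$; (b2) if $\omega_{-1}(0)=\nu(1+v_c(0))$, the solution exists for all $t>0$, and $\omega_{-1}(t),v_c(t)\to\infty$ like $e^{\nu t}$ as $t\to\infty$; in both (b1) and (b2), $\|\omega\|_{L^\infty}\to\nu$, $\|\omega\|_{B_0}\to2\nu$ and $\|\omega\|_{L^2}\to0$ like $e^{-\nu t/2}$ as $t\to\infty$; (c1) if $\omega_{-1}(0)<-\nu v_c(0)(1+v_c(0))$, the solution exists until $$t_c=\frac1\nu\ln\left(\frac{\omega_{-1}(0)}{\omega_{-1}(0)+\nu v_c(0)(1+v_c(0))}\right),$$ with $v_c(t_c)=0$ and blow-up location $x_c=0$; in this case $\|\omega(\cdot,0)\|_{L^\infty}>\nu(1+v_c(0))$, $\|\omega(\cdot,0)\|_{L^2}>2\nu\sqrt{\pi v_c(0)}$, $\|\omega(\cdot,0)\|_{B_0}>2\nu$ if $v_c(0)<1$ and $\|\omega(\cdot,0)\|_{B_0}>2\nu v_c(0)$ if $v_c(0)\ge1$, and $\|\omega(\cdot,0)\|_{L^2}$ can be made arbitrarily small by choosing $v_c(0)$ small enough; (c2) if $\omega_{-1}(0)>\nu(1+v_c(0))$, the solution exists until $$t_c=\frac1\nu\ln\left(\frac{\omega_{-1}(0)}{\omega_{-1}(0)-\nu(1+v_c(0))}\right),$$ with $v_c(t)\to\infty$ as $t\to t_c^-$ and blow-up location $x_c=\pm\pi$; in this case $\|\omega(\cdot,0)\|_{L^\infty}>\nu(1+1/v_c(0))$, $\|\omega(\cdot,0)\|_{L^2}>2\nu\sqrt{\pi/v_c(0)}$,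 $\|\omega(\cdot,0)\|_{B_0}>2\nu/v_c(0)$ if $v_c(0)<1$ and $\|\omega(\cdot,0)\|_{B_0}>2\nu$ if $v_c(0)\ge1$, and $\|\omega(\cdot,0)\|_{L^2}$ can be made arbitrarily small by choosing $v_c(0)$ large enough. In both (c1) and (c2), $\|\omega(\cdot,t)\|_{L^\infty}\to\infty$ and $\|\omega(\cdot,t)\|_{L^2}\to\infty$ as $t\to t_c^-$.
   Context: $\mathcal{H}$ is the periodic Hilbert transform, $\mathcal{H}f(x)=\frac1{2\pi}\mathrm{PV}\int_{-\pi}^\pi f(x')\cot\left(\frac{x-x'}2\right)dx'$, with Fourier symbol $-i\,\mathrm{sgn}(k)$. $\|f\|_{B_0}=\sum_{k\in\mathbb{Z}}|\hat f(k)|$ is the Wiener norm, where $f(x)=\sum_k\hat f(k)e^{ikx}$; $L^2=L^2[-\pi,\pi]$. The equation is the generalized Constantin–Lax–Majda equation $\omega_t=-au\omega_x+\omega\mathcal{H}(\omega)-\nu\Lambda^\sigma\omega$ with $a=0$, $\sigma=0$ on zero-mean functions. For real $x$, $\omega=2\,\mathrm{Re}\,\omega_-$. *)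

(* Defs.v *)
From HB Require Import structures.
From mathcomp Require Import all_boot all_order all_algebra.
From mathcomp Require Import all_classical all_reals all_analysis.
From mathcomp Require Export complex.

Set Implicit Arguments.
Unset Strict Implicit.
Unset Printing Implicit Defensive.

Import Order.TTheory GRing.Theory Num.Theory.
Import numFieldNormedType.Exports.

Local Open Scope classical_set_scope.
Local Open Scope ring_scope.

(* Functions on the circle are functions on R; only their values on [-pi, pi]
   enter the norms and integrals below. *)

Section Circle.
Context {R : realType}.
Implicit Types f : R -> R.

Definition circle : set R := `[- pi, pi].

Definition Linf_norm f : \bar R :=
  Lnorm (@lebesgue_measure R) +oo%E (EFin \o (f \_ circle)).

Definition L2_norm f : \bar R :=
  Lnorm (@lebesgue_measure R) 2%:E (EFin \o (f \_ circle)).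

(* (2 pi)^-1 * \int f(x) e^{-ikx} dx, split into real and imaginary parts *)
Definition fourier_coef f (k : int) : R[i] :=
  Complex
    ((2 * pi)^-1 *
       \int[@lebesgue_measure R]_(x in circle) (f x * cos (k%:~R * x)))
    (- ((2 * pi)^-1 *
       \int[@lebesgue_measure R]_(x in circle) (f x * sin (k%:~R * x)))).

Definition wiener_norm f : \bar R :=
  esum [set: int] (fun k => (ComplexField.Normc.normc (fourier_coef f k))%:E).

(* The cut-off is symmetric with respect to the distance on the circle, so that
   the principal value is also the right one at the endpoints x = -pi, pi. *)
Definition hilbert_trunc f (x e : R) : R :=
  (2 * pi)^-1 *
    \int[@lebesgue_measure R]_(y in
        [set y | circle y /\ forall k : int, e <= `|x - y - 2 * pi * k%:~R|])
      (f y * (cos ((x - y) / 2) / sin ((x - y) / 2))).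

Definition hilbert_exists f (x : R) : Prop :=
  cvg (hilbert_trunc f x e @[e --> 0^'+]).

Definition hilbert f (x : R) : R := lim (hilbert_trunc f x e @[e --> 0^'+]).

(* Classical zero-mean solution of u_t = u H(u) - nu u on the time interval
   [0, T), with T = +oo allowed; u is applied to x first, then to t. *)
Record is_solution (nu : R) (T : \bar R) (u : R -> R -> R) : Prop := {
  sol_continuous :
    {within [set z : R * R | 0 <= z.2 /\ (z.2%:E < T)%E],
      continuous (fun z : R * R => u z.1 z.2)};
  sol_periodic : forall x t : R,
    0 <= t -> (t%:E < T)%E -> u (x + 2 * pi) t = u x t;
  sol_zero_mean : forall t : R, 0 <= t -> (t%:E < T)%E ->
    \int[@lebesgue_measure R]_(x in circle) u x t = 0;
  sol_hilbert : forall x t : R,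
    0 < t -> (t%:E < T)%E -> hilbert_exists (u^~ t) x;
  sol_equation : forall x t : R, 0 < t -> (t%:E < T)%E ->
    is_derive t 1 (u x) (u x t * hilbert (u^~ t) x - nu * u x t)
}.

(* u is a solution on [0, tc) that is not the restriction of a solution on a
   longer time interval. *)
Definition solution_until (nu tc : R) (u : R -> R -> R) : Prop :=
  [/\ 0 < tc, is_solution nu tc%:E u &
      forall (T : \bar R) (u' : R -> R -> R), (tc%:E < T)%E ->
        (forall x t : R, 0 <= t -> t < tc -> u' x t = u x t) ->
        ~ is_solution nu T u'].

(* Points of the circle near which u is unbounded as t tends to tc from below *)
Definition blowup_points (u : R -> R -> R) (tc : R) : set R :=
  [set x | circle x /\
    forall d M : R, 0 < d -> exists y t : R,
      [/\ circle y, `|y - x| < d, 0 <= t, tc - d < t < tc & M < `|u y t|]].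

(* "f(t) behaves like g(t)" as t tends to +oo *)
Definition behaves_like (f g : R -> R) : Prop :=
  exists c : R, c != 0 /\ f t / g t @[t --> +oo] --> c.

End Circle.

(* v0 and w0 are the initial values of v_c and omega_{-1}. *)

Section ExplicitSolution.
Context {R : realType}.
Variables nu v0 w0 : R.

Definition vc_num (t : R) : R :=
  w0 * (1 - expR (- (nu * t))) + nu * v0 * (1 + v0).

Definition vc_den (t : R) : R :=
  - w0 * (1 - expR (- (nu * t))) + nu * (1 + v0).

Definition vc (t : R) : R := vc_num t / vc_den t.

(* 0 < v_c(t) < oo: a zero denominator is an infinite value of v_c *)
Definition vc_pos_finite (t : R) : Prop := vc_den t != 0 /\ 0 < vc t.

Definition omega_m1 (t : R) : R := derive1 vc t.

(* At odd multiples of pi, tan(x/2) is infinite and 1 / (tan(x/2) - i v_c) is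
   0; this is not what the total functions tan and ^-1 would return there. *)
Definition omega_minus (x t : R) : R[i] :=
  real_complex R (omega_m1 t) *
  ((if cos (x / 2) == 0 then 0
    else (real_complex R (tan (x / 2)) - 'i%C * real_complex R (vc t))^-1)
   - (- 'i%C - 'i%C * real_complex R (vc t))^-1).

(* x is real here, hence equal to its conjugate *)
Definition omega_plus (x t : R) : R[i] := conjc (omega_minus x t).

Definition omegaC (x t : R) : R[i] := omega_minus x t + omega_plus x t.

Definition omega (x t : R) : R := complex.Re (omegaC x t).

End ExplicitSolution.

(* Main.v *)
Require Import Defs.
From HB Require Import structures.
From mathcomp Require Import all_boot all_order all_algebra.
From mathcomp Require Import all_classical all_reals all_analysis.
From mathcomp Require Import complex.
From mathcomp Require Import ring lra ess_sup_inf.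
Set Implicit Arguments.
Unset Strict Implicit.
Unset Printing Implicit Defensive.
Import Order.TTheory GRing.Theory Num.Theory.
Import numFieldNormedType.Exports.
Local Open Scope classical_set_scope.
Local Open Scope ring_scope.

(** Put q = (1 - v_c) / (1 + v_c) and A = 4 omega_{-1} / (1 + v_c)^2.  On the
    real line the proposed solution is A S_q with
      S_q(x) = sin x / (1 - 2 q cos x + q^2) = sum_(k >= 1) q^(k-1) sin (k x),
    and 0 < v_c < oo means |q| < 1 ([omegaE], [vc_pos_finiteP]).  With
      C_q(x) = (cos x - q) / (1 - 2 q cos x + q^2) = sum_(k >= 1) q^(k-1) cos (k x)
    one has H S_q = - C_q ([hilbert_trunc_sin_kernel]) and d S_q / dq = 2 S_q C_q.
    Hence the equation for A S_q reduces to A' = - nu A and q' = - A / 2.  The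
    formula for v_c solves precisely this: it makes q affine in exp (- nu t)
    ([is_derive_pole], [is_derive_amplitude], [omega_is_solution]).

    The integrals of cos (k x) and sin (k x) against the Poisson denominator
    satisfy a three-term recurrence, whose bounded solutions are geometric
    ([linear_rec_geometric]); this gives the Fourier coefficients and the three
    norms |A| / (1 - q^2), sqrt (pi A^2 / (1 - q^2)) and |A| / (1 - |q|)
    ([Linf_norm_sin_kernel], [L2_norm_sin_kernel], [wiener_norm_sin_kernel]).
    For the principal value, S_q(y) - S_q(x) times cot ((x - y) / 2) is a
    trigonometric polynomial over the same denominators ([sin_kernel_half_cot]),
    and the truncated integral of the cotangent vanishes.

    What remains is the motion of q in ]-1, 1[.  Inside the admissible range of
    the initial data q never leaves the interval; at an end of the range it tends
    to s = 1 or s = -1 exponentially, with |A| proportional to 1 - s q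
    ([borderline_norms]); beyond an end it reaches s at the finite time t_c with
    A(t_c) != 0.  In the last case the maximum |A| / (1 - q^2) tends to infinity,
    whereas A S_q stays bounded away from the points where cos x = s, so these
    points are the blow-up points ([blowup_peak], [not_blowup]).  A solution on
    a longer time interval would be continuous, hence bounded, near such a point
    ([blowup_no_extension]). *)


(** * Trigonometric integrals on the circle *)

Section Kernel.
Context {R : realType}.
Implicit Types (q x y : R).

(** |1 - q e^(ix)|^2, the denominator of the Poisson kernel. *)
Definition poisson_den q x : R := 1 - 2 * q * cos x + q ^+ 2.

(** The generating function sum_(k >= 1) q^(k-1) sin (k x). *)
Definition sin_kernel q x : R := sin x / poisson_den q x.

(** The generating function sum_(k >= 1) q^(k-1) cos (k x). *)
Definition cos_kernel q x : R := (cos x - q) / poisson_den q x.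

Lemma poisson_den_sqr q x : poisson_den q x = (q - cos x) ^+ 2 + sin x ^+ 2.
Proof. by rewrite /poisson_den sin2cos2; ring. Qed.

Lemma poisson_den_gt0 q x : `|q| < 1 -> 0 < poisson_den q x.
Proof.
move=> q1; rewrite lt_neqAle eq_sym poisson_den_sqr addr_ge0 ?sqr_ge0// andbT.
rewrite paddr_eq0 ?sqr_ge0// !sqrf_eq0 subr_eq0; apply/negP => /andP[/eqP qc /eqP s0].
by move: q1; rewrite qc sin0cos1// ltxx.
Qed.

Lemma continuous_poisson_den q : continuous (poisson_den q).
Proof.
move=> x; apply: cvgD; last exact: cvg_cst.
apply: cvgB; first exact: cvg_cst.
by apply: cvgM; [exact: cvg_cst|exact: continuous_cos].
Qed.

Lemma continuous_div_poisson q (f : R -> R) : `|q| < 1 -> continuous f ->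
  continuous (fun x => f x / poisson_den q x).
Proof.
move=> q1 cf x; apply: cvgM; first exact: cf.
by apply: cvgV; [rewrite gt_eqF// poisson_den_gt0|exact: continuous_poisson_den].
Qed.

Lemma circle_integrable (f : R -> R) : continuous f ->
  (@lebesgue_measure R).-integrable circle (EFin \o f).
Proof.
move=> cf; apply: continuous_compact_integrable; first exact: segment_compact.
exact: continuous_subspaceT.
Qed.

Lemma itv_integrable (f : R -> R) a b : {within `[a, b], continuous f} ->
  (@lebesgue_measure R).-integrable `[a, b] (EFin \o f).
Proof. by apply: continuous_compact_integrable; exact: segment_compact. Qed.

Lemma Rintegral_FTC (f F : R -> R) a b : a < b ->
  {within `[a, b], continuous f} ->
  (forall x, a <= x <= b -> is_derive x 1 F (f x)) ->
  \int[@lebesgue_measure R]_(x in `[a, b]) f x = F b - F a.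
Proof.
move=> ab cf dF; rewrite /Rintegral (continuous_FTC2 ab cf (F := F))//.
  have cF x : a <= x <= b -> {for x, continuous F}.
    move=> xab; apply: differentiable_continuous; apply/derivable1_diffP.
    by have [] := dF _ xab.
  split.
  - by move=> x; rewrite in_itv/= => /andP[/ltW ax /ltW xb]; have [] := dF x; rewrite ?ax.
  - by apply: cvg_at_right_filter; apply: cF; rewrite lexx ltW.
  - by apply: cvg_at_left_filter; apply: cF; rewrite lexx ltW.
move=> x; rewrite in_itv/= => /andP[/ltW ax /ltW xb].
by rewrite derive1E; apply: derive_val; apply: dF; rewrite ax.
Qed.

(** Iterating gives b n = q^m b (n + m), which tends to 0 with m. *)
Lemma bounded_backward_rec q (b : nat -> R) M : `|q| < 1 ->
  (forall n, `|b n| <= M) -> (forall n, b n = q * b n.+1) -> forall n, b n = 0.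
Proof.
move=> q1 bM bq n; apply/normr0_eq0/le_anti; rewrite normr_ge0 andbT.
have bE m : b n = q ^+ m * b (n + m)%N.
  by elim: m => [|m ->]; rewrite ?addn0 ?mul1r// addnS exprSr -mulrA -bq.
have : (fun m => `|q| ^+ m * M) @ \oo --> (0 * M).
  by apply: cvgM; [apply: cvg_expr; rewrite normr_id|exact: cvg_cst].
rewrite mul0r => cv; apply: (ler_cvg_to (cvg_cst `|b n|) cv).
by near=> m; rewrite (bE m) normrM normrX ler_wpM2l.
Unshelve. all: by end_near. Qed.

Notation cint f := (\int[@lebesgue_measure R]_(x in circle) f x).

Lemma cintD (f g : R -> R) : continuous f -> continuous g ->
  cint (fun x => f x + g x) = cint f + cint g.
Proof. by move=> cf cg; rewrite RintegralD//;
  [exact: measurable_itv|exact: circle_integrable..]. Qed.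

Lemma cintZ (f : R -> R) c : continuous f -> cint (fun x => c * f x) = c * cint f.
Proof. by move=> cf; rewrite RintegralZl//; [exact: measurable_itv|exact: circle_integrable]. Qed.

Lemma circle_lt : - pi < pi :> R.
Proof. by rewrite gtrN// pi_gt0. Qed.

Lemma cint_cst c : cint (fun=> c) = c * (2 * pi).
Proof.
rewrite Rintegral_cst/=; last exact: measurable_itv.
rewrite lebesgue_measure_itv/= lte_fin circle_lt -EFinB /=.
by congr (_ * _); ring.
Qed.

Lemma cint_bounded (f : R -> R) M : continuous f -> (forall x, `|f x| <= M) ->
  `|cint f| <= M * (2 * pi).
Proof.
move=> cf fM; rewrite (le_trans (le_normr_Rintegral _ (circle_integrable cf)))//.
  exact: measurable_itv.
rewrite -cint_cst; apply: le_Rintegral => //; first exact: measurable_itv.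
- by apply: (@circle_integrable (fun x => `|f x|)) => x; apply: cvg_norm; exact: cf.
- by apply: (@circle_integrable (fun=> M)) => x; exact: cvg_cst.
Qed.

Lemma cint_FTC (f F : R -> R) : continuous f -> (forall x, is_derive x 1 F (f x)) ->
  cint f = F pi - F (- pi).
Proof.
move=> cf dF; apply: Rintegral_FTC => //; first exact: circle_lt.
exact: continuous_subspaceT.
Qed.

Lemma continuous_cosM a : continuous (fun x => cos (a * x)).
Proof.
by move=> x; apply: (@continuous_comp _ _ _ ( *%R a) cos);
  [exact: mulrl_continuous|exact: continuous_cos].
Qed.

Lemma continuous_sinM a : continuous (fun x => sin (a * x)).
Proof.
by move=> x; apply: (@continuous_comp _ _ _ ( *%R a) sin);
  [exact: mulrl_continuous|exact: continuous_sin].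
Qed.

Lemma sinn_pi n : sin (n%:R * pi) = 0 :> R.
Proof.
elim: n => [|n IH]; first by rewrite mul0r sin0.
by rewrite -natr1 mulrDl mul1r sinDpi IH oppr0.
Qed.

Lemma is_derive_sinM a x : is_derive x 1 (fun x => sin (a * x)) (a * cos (a * x)).
Proof.
have -> : (fun x => sin (a * x)) = sin \o ( *%R a) by [].
apply: is_derive_eq.
rewrite /GRing.scale /=; ring.
Qed.

Lemma is_derive_cosM a x : is_derive x 1 (fun x => cos (a * x)) (- a * sin (a * x)).
Proof.
have -> : (fun x => cos (a * x)) = cos \o ( *%R a) by [].
apply: is_derive_eq.
rewrite /GRing.scale /=; ring.
Qed.

Lemma cint_cosn n : cint (fun x => cos (n.+1%:R * x)) = 0.
Proof.
have dF x : is_derive x 1 (fun x => n.+1%:R^-1 * sin (n.+1%:R * x)) (cos (n.+1%:R * x)).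
  have ds := is_derive_sinM n.+1%:R x.
  by apply: is_derive_eq; rewrite /GRing.scale/=; field; rewrite nat1r pnatr_eq0.

by rewrite (cint_FTC (@continuous_cosM _) dF) mulrN sinN sinn_pi; ring.
Qed.

Lemma cint_sinn n : cint (fun x => sin (n%:R * x)) = 0.
Proof.
case: n => [|n].
  rewrite (_ : (fun x => _) = cst 0) ?cint_cst ?mul0r//.
  by apply/funext => x; rewrite mul0r sin0.
have dF x : is_derive x 1 (fun x => - (n.+1%:R^-1 * cos (n.+1%:R * x))) (sin (n.+1%:R * x)).
  have ds := is_derive_cosM n.+1%:R x.
  by apply: is_derive_eq; rewrite /GRing.scale/=; field; rewrite nat1r pnatr_eq0.
by rewrite (cint_FTC (@continuous_sinM _) dF) mulrN cosN; ring.
Qed.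

Section integrals.
Variable q : R.
Hypothesis q1 : `|q| < 1.

Lemma one_sub_sqr_gt0 : 0 < 1 - q ^+ 2.
Proof. by move: q1; rewrite ltr_norml => /andP[]; nra. Qed.

Lemma poisson_den_ge x : (1 - `|q|) ^+ 2 <= poisson_den q x.
Proof.
rewrite /poisson_den -[in leRHS](real_normK (num_real q)) sqrrB expr1n mul1r -subr_ge0.
have : q * cos x <= `|q|.
  by rewrite (le_trans (ler_norm _))// normrM ler_piMr// cos_max.
by rewrite -mulr_natl; lra.
Qed.

Lemma div_poisson_bounded (f : R -> R) M x : (forall x, `|f x| <= M) ->
  `|f x / poisson_den q x| <= M / (1 - `|q|) ^+ 2.
Proof.
move=> fM; rewrite normrM normfV [`|poisson_den _ _|]gtr0_norm ?poisson_den_gt0//.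
apply: ler_pM => //; first by rewrite invr_ge0 ltW// poisson_den_gt0.
by rewrite lef_pV2 ?poisson_den_ge// posrE ?poisson_den_gt0 ?exprn_gt0 ?subr_gt0.
Qed.

(** The differences p (n+1) - q p n satisfy a bounded backward recurrence of
    ratio q, so they vanish; boundedness excludes the other solution q^(-n). *)
Lemma linear_rec_geometric (p : nat -> R) M : (forall n, `|p n| <= M) ->
  (forall n, (1 + q ^+ 2) * p n.+1 = q * (p n.+2 + p n)) ->
  forall n, p n = q ^+ n * p 0%N.
Proof.
move=> pM pE.
have b0 n : p n.+1 - q * p n = 0.
  apply: (@bounded_backward_rec q (fun n => p n.+1 - q * p n) (M + M)) => // m.
    rewrite (le_trans (ler_normB _ _))// lerD// normrM.
    by rewrite (le_trans (ler_piMl _ (ltW q1))).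
  by have := pE m; lra.
elim=> [|n IH]; first by rewrite mul1r.
by rewrite exprS -mulrA -IH; apply/eqP; rewrite -subr_eq0 b0.
Qed.

Lemma natrS_mulD n x : n.+2%:R * x = n.+1%:R * x + x.
Proof. by rewrite -(natr1 n.+1) mulrDl mul1r. Qed.

Lemma natrn_mulB n x : n%:R * x = n.+1%:R * x - x.
Proof. by rewrite -(natr1 n) mulrDl mul1r addrK. Qed.

Lemma cos_rec n x : cos (n.+2%:R * x) + cos (n%:R * x) = 2 * cos x * cos (n.+1%:R * x).
Proof.
by rewrite natrS_mulD (natrn_mulB n) cosD cosB; ring.
Qed.

Lemma sin_rec n x : sin (n.+2%:R * x) + sin (n%:R * x) = 2 * cos x * sin (n.+1%:R * x).
Proof.
by rewrite natrS_mulD (natrn_mulB n) sinD sinB; ring.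
Qed.

(** Multiply and divide by 1 + q^2 = poisson_den + 2 q cos x, and use the
    product formula for 2 cos x times the n-th harmonic. *)
Lemma div_poisson_rec (e : nat -> R -> R) n :
  (forall n, continuous (e n)) ->
  (forall x, e n.+2 x + e n x = 2 * cos x * e n.+1 x) ->
  (1 + q ^+ 2) * cint (fun x => e n.+1 x / poisson_den q x) =
  q * (cint (fun x => e n.+2 x / poisson_den q x) + cint (fun x => e n x / poisson_den q x)) +
    cint (e n.+1).
Proof.
move=> ce eE; have ck m := continuous_div_poisson q1 (ce m).
rewrite -cintD//.
have ckD : continuous (fun x => e n.+2 x / poisson_den q x + e n x / poisson_den q x).
  by move=> x; apply: cvgD; exact: ck.
rewrite -!cintZ// -cintD//; last by move=> x; apply: cvgM; [exact: cvg_cst|exact: ckD].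
apply: eq_Rintegral => x _; rewrite -mulrDl eE /poisson_den.
have := poisson_den_gt0 x q1; rewrite /poisson_den => k0.
by field; rewrite gt_eqF.
Qed.

(** The bounded recurrence determines the integrals up to their value at
    n = 0, which the relation for n = 0 (where the harmonics n = 1 and n = -1
    coincide) fixes. *)
Lemma cint_cosn_poisson_den n :
  cint (fun x => cos (n%:R * x) / poisson_den q x) = 2 * pi * q ^+ n / (1 - q ^+ 2).
Proof.
pose p n := cint (fun x => cos (n%:R * x) / poisson_den q x).
have ccos m : continuous (fun x => cos (m%:R * x)) by exact: continuous_cosM.
have pE m : p m = q ^+ m * p 0%N.
  apply: (@linear_rec_geometric p (1 / (1 - `|q|) ^+ 2 * (2 * pi))) => k.
    apply: cint_bounded; first exact: continuous_div_poisson.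
    by move=> x; apply: (div_poisson_bounded (f := fun x => cos (k%:R * x))) => ?; exact: cos_max.
  rewrite /p (@div_poisson_rec (fun m x => cos (m%:R * x)))//; last by move=> x; exact: cos_rec.
  by rewrite cint_cosn addr0.
have p0 : (1 + q ^+ 2) * p 0%N = 2 * q * p 1%N + 2 * pi.
  have ck m := continuous_div_poisson q1 (ccos m).
  have ck1 : continuous (fun x => 2 * q * (cos (1%:R * x) / poisson_den q x)).
    by move=> x; apply: cvgM; [exact: cvg_cst|exact: ck].
  rewrite /p -[X in _ = _ + X]mul1r -cint_cst -!cintZ// -cintD//; last by move=> ?;
    exact: cvg_cst.
  apply: eq_Rintegral => x _; rewrite mul0r cos0 (mul1r x) mul1r /poisson_den.
  by have := poisson_den_gt0 x q1; rewrite /poisson_den => k0; field; rewrite gt_eqF.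
rewrite -/(p n) pE.
suff -> : p 0%N = 2 * pi / (1 - q ^+ 2) by ring.
have := pE 1%N; rewrite expr1 => p1.
have k0 : 1 - q ^+ 2 != 0 by rewrite gt_eqF// one_sub_sqr_gt0.
apply: (mulIf k0); rewrite divfK//.
have -> : p 0%N * (1 - q ^+ 2) = (1 + q ^+ 2) * p 0%N - 2 * q * (q * p 0%N) by ring.
by rewrite p0 p1; ring.
Qed.

Lemma cint_sinn_poisson_den n : cint (fun x => sin (n%:R * x) / poisson_den q x) = 0.
Proof.
pose p n := cint (fun x => sin (n%:R * x) / poisson_den q x).
have csin m : continuous (fun x => sin (m%:R * x)) by exact: continuous_sinM.
have pE m : p m = q ^+ m * p 0%N.
  apply: (@linear_rec_geometric p (1 / (1 - `|q|) ^+ 2 * (2 * pi))) => k.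
    apply: cint_bounded; first exact: continuous_div_poisson.
    by move=> x; apply: (div_poisson_bounded (f := fun x => sin (k%:R * x))) => ?; exact: sin_max.
  rewrite /p (@div_poisson_rec (fun m x => sin (m%:R * x)))//; last by move=> x; exact: sin_rec.
  by rewrite cint_sinn addr0.
rewrite -/(p n) pE /p (_ : (fun x => _) = cst 0) ?cint_cst ?mul0r ?mulr0//.
by apply/funext => x; rewrite mul0r sin0 mul0r.
Qed.

(** The product sin x sin ((n+1) x) is half a difference of two cosines. *)
Lemma cint_sin_kernel_sin n :
  cint (fun x => sin_kernel q x * sin (n.+1%:R * x)) = pi * q ^+ n.
Proof.
have ck m : continuous (fun x => cos (m%:R * x) / poisson_den q x).
  by apply: continuous_div_poisson => //; exact: continuous_cosM.
have -> : cint (fun x => sin_kernel q x * sin (n.+1%:R * x)) =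
    2^-1 * (cint (fun x => cos (n%:R * x) / poisson_den q x) +
       -1 * cint (fun x => cos (n.+2%:R * x) / poisson_den q x)).
  have ckN : continuous (fun x => -1 * (cos (n.+2%:R * x) / poisson_den q x)).
    by move=> x; apply: cvgM; [exact: cvg_cst|exact: ck].
  have ckD : continuous (fun x => cos (n%:R * x) / poisson_den q x +
      -1 * (cos (n.+2%:R * x) / poisson_den q x)).
    by move=> x; apply: cvgD; [exact: ck|exact: ckN].
  rewrite -cintZ// -cintD// -cintZ//; apply: eq_Rintegral => x _.
  by rewrite /sin_kernel natrS_mulD (natrn_mulB n) cosB cosD; field;
    rewrite gt_eqF// poisson_den_gt0.
by rewrite !cint_cosn_poisson_den !exprS; field; rewrite gt_eqF// one_sub_sqr_gt0.
Qed.

Lemma cint_sin_kernel_cos n : cint (fun x => sin_kernel q x * cos (n%:R * x)) = 0.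
Proof.
have ck m : continuous (fun x => sin (m%:R * x) / poisson_den q x).
  by apply: continuous_div_poisson => //; exact: continuous_sinM.
case: n => [|n].
  rewrite -(cint_sinn_poisson_den 1); apply: eq_Rintegral => x _.
  by rewrite mul0r cos0 mulr1 mul1r.
have -> : cint (fun x => sin_kernel q x * cos (n.+1%:R * x)) =
    2^-1 * (-1 * cint (fun x => sin (n%:R * x) / poisson_den q x) +
       cint (fun x => sin (n.+2%:R * x) / poisson_den q x)).
  have ckN : continuous (fun x => -1 * (sin (n%:R * x) / poisson_den q x)).
    by move=> x; apply: cvgM; [exact: cvg_cst|exact: ck].
  have ckD : continuous (fun x => -1 * (sin (n%:R * x) / poisson_den q x) +
      sin (n.+2%:R * x) / poisson_den q x).
    by move=> x; apply: cvgD; [exact: ckN|exact: ck].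
  rewrite -cintZ// -cintD// -cintZ//; apply: eq_Rintegral => x _.
  by rewrite /sin_kernel natrS_mulD (natrn_mulB n) sinB sinD; field;
    rewrite gt_eqF// poisson_den_gt0.
by rewrite !cint_sinn_poisson_den; ring.
Qed.

Lemma is_derive_poisson_den x : is_derive x 1 (poisson_den q) (2 * q * sin x).
Proof.
rewrite /poisson_den; apply: is_derive_eq.
by rewrite /GRing.scale/=; ring.
Qed.

Lemma is_derive_sin_kernel x : is_derive x 1 (sin_kernel q)
  (cos (1%:R * x) / poisson_den q x + (- (2 * q)) * sin_kernel q x ^+ 2).
Proof.
have k0 : poisson_den q x != 0 by rewrite gt_eqF// poisson_den_gt0.
have dk := is_derive_poisson_den x.
have dV := is_deriveV k0 dk.
rewrite /sin_kernel; apply: is_derive_eq.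
rewrite /GRing.scale/= mul1r; field.
by [].
Qed.

(** The derivative of S_q is cos x / poisson_den - 2 q S_q^2 and has integral
    0 by periodicity; for q = 0 this says nothing, but then S_q = sin. *)
Lemma cint_sin_kernel_sqr : cint (fun x => sin_kernel q x ^+ 2) = pi / (1 - q ^+ 2).
Proof.
have csk : continuous (sin_kernel q) by apply: continuous_div_poisson => //;
  exact: continuous_sin.
have csk2 : continuous (fun x => sin_kernel q x ^+ 2).
  by move=> x; apply: cvgM; exact: csk.
have [q0|q0] := eqVneq q 0.
  have -> : pi / (1 - q ^+ 2) = pi * q ^+ 0 by rewrite q0 expr0 expr0n/= subr0 divr1 mulr1.
  rewrite -cint_sin_kernel_sin; apply: eq_Rintegral => x _.
  by rewrite mul1r expr2 {2}/sin_kernel /poisson_den q0 mulr0 mul0r subr0 expr0n/= addr0 divr1.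
have c1 : continuous (fun x => cos (1%:R * x) / poisson_den q x).
  by apply: continuous_div_poisson => //; exact: continuous_cosM.
have c2 : continuous (fun x => - (2 * q) * sin_kernel q x ^+ 2).
  by move=> x; apply: cvgM; [exact: cvg_cst|exact: csk2].
have c3 : continuous (fun x => cos (1%:R * x) / poisson_den q x + - (2 * q) * sin_kernel q x ^+ 2).
  by move=> x; apply: cvgD; [exact: c1|exact: c2].
have := cint_FTC c3 is_derive_sin_kernel.
rewrite cintD// cintZ// cint_cosn_poisson_den /sin_kernel sinN sinpi oppr0 !mul0r subrr expr1.
set I := (X in _ + _ * X = _) => IE.
have q20 : 1 - q ^+ 2 != 0 by rewrite gt_eqF// one_sub_sqr_gt0.
have q22 : 2 * q != 0 by rewrite mulf_neq0.
apply: (mulfI q22).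
have -> : 2 * q * I = 2 * pi * q / (1 - q ^+ 2) by lra.
by field.
Qed.

End integrals.
End Kernel.

(** * The Hilbert transform of the kernel *)

Section Hilbert.
Context {R : realType}.
Implicit Types (q x y e : R).
Notation mu := (@lebesgue_measure R).
Notation cint f := (\int[mu]_(x in circle) f x).

Lemma Rintegral_itv_split (f : R -> R) a b c : a <= b -> b <= c ->
  {within `[a, c], continuous f} ->
  \int[mu]_(x in `[a, c]) f x = \int[mu]_(x in `[a, b]) f x + \int[mu]_(x in `[b, c]) f x.
Proof.
move=> ab bc cf; have intf := itv_integrable cf.
rewrite -(Rintegral_itv_obnd_cbnd (r := b)); last first.
  by apply: integrableS intf => //; apply: subset_itvr; rewrite bnd_simp.
by rewrite -(Rintegral_itvB intf (x := b)) ?bnd_simp// addrC subrK.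
Qed.

Lemma Rintegral_itv_bounded (f : R -> R) M a b : a <= b -> continuous f ->
  (forall x, `|f x| <= M) ->
  `|\int[mu]_(x in `[a, b]) f x| <= M * (b - a).
Proof.
move=> ab cf fM.
rewrite (le_trans (le_normr_Rintegral _ (itv_integrable (continuous_subspaceT cf))))//.
have -> : M * (b - a) = \int[mu]_(x in `[a, b]) cst M x.
  rewrite Rintegral_cst//= lebesgue_measure_itv/= lte_fin.
  by have [ab'|ba] := ltP a b; [rewrite -EFinD|rewrite (le_anti (_ : a <= b <= a)) ?ab// subrr].
by apply: le_Rintegral => //; apply: itv_integrable; apply: continuous_subspaceT => x;
  [apply: cvg_norm; exact: cf|exact: cvg_cst].
Qed.

(** The kernel of the periodic Hilbert transform. *)
Definition half_cot x y : R := cos ((x - y) / 2) / sin ((x - y) / 2).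

Lemma half_cotD2pi x y : half_cot (x + 2 * pi) y = half_cot x y.
Proof.
rewrite /half_cot; have -> : (x + 2 * pi - y) / 2 = (x - y) / 2 + pi by field.
by rewrite sinDpi cosDpi invrN mulrNN.
Qed.

Lemma continuous_half_cot x y : sin ((x - y) / 2) != 0 -> {for y, continuous (half_cot x)}.
Proof.
move=> s0.
have cd : {for y, continuous (fun y => (x - y) / 2)}.
  by apply: cvgM; [apply: cvgB; [exact: cvg_cst|exact: cvg_id]|exact: cvg_cst].
apply: cvgM; first by apply: (continuous_comp cd); exact: continuous_cos.
by apply: cvgV => //; apply: (continuous_comp cd); exact: continuous_sin.
Qed.

Lemma sin_half_gt0 x y : x < y -> y < x + 2 * pi -> 0 < sin ((y - x) / 2).
Proof.
by move=> xy yx; apply: sin_gt0_pi; apply/andP; split; lra.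
Qed.

Lemma sin_half_neq0 x y : x < y -> y < x + 2 * pi -> sin ((x - y) / 2) != 0.
Proof.
move=> xy yx; rewrite -opprB mulNr sinN oppr_eq0 gt_eqF//; exact: sin_half_gt0.
Qed.

(** An antiderivative is -2 ln (sin ((y - x) / 2)) as long as y stays in one
    period to the right of x. *)
Lemma Rintegral_half_cot x a b : x < a -> a < b -> b < x + 2 * pi ->
  \int[mu]_(y in `[a, b]) half_cot x y =
  - (2 * ln (sin ((b - x) / 2))) + 2 * ln (sin ((a - x) / 2)).
Proof.
move=> xa ab bx.
have cc : {within `[a, b], continuous (half_cot x)}.
  apply: continuous_in_subspaceT => y; rewrite inE/= in_itv/= => /andP[ay yb].
  by apply: continuous_half_cot; apply: sin_half_neq0; lra.
have dF y : a <= y <= b -> is_derive y 1 (fun y => - (2 * ln (sin ((y - x) / 2)))) (half_cot x y).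
  move=> /andP[ay yb].
  have s0 : 0 < sin ((y - x) / 2) by apply: sin_half_gt0; lra.
  have ds : is_derive y 1 (fun y => sin ((y - x) / 2)) (cos ((y - x) / 2) / 2).
    have -> : (fun y => sin ((y - x) / 2)) = sin \o (fun y => (y - x) / 2) by [].
    by apply: is_derive_eq; rewrite /GRing.scale/=; field.
  have dl := is_derive1_ln s0.
  have dc : is_derive y 1 (@ln R \o (fun y => sin ((y - x) / 2))) (2^-1 * cos ((y - x) / 2) /
    sin ((y - x) / 2)).
    by apply: is_derive_eq; rewrite /GRing.scale/=; field; rewrite gt_eqF.
  have -> : (fun y => - (2 * ln (sin ((y - x) / 2))))
    = (fun y => - (2 * (@ln R \o (fun y => sin ((y - x) / 2))) y)) by [].
  apply: is_derive_eq; rewrite /GRing.scale/=/half_cot -[x - y]opprB mulNr sinN cosN.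
  by field; rewrite gt_eqF.
by rewrite (Rintegral_FTC ab cc dF) opprK.
Qed.

Section regularised.
Variables (q x : R).
Hypothesis q1 : `|q| < 1.

(** The quotient (S_q(y) - S_q(x)) cot ((x - y) / 2), written without the
    singularity at y = x. *)
Definition diff_kernel y : R :=
  - (poisson_den q x)^-1 * ((1 + q ^+ 2) * (cos x + cos y) - 2 * q * (1 + cos (x - y))) /
    poisson_den q y.

(** Write y = x - 2 d.  The numerator of S_q(y) - S_q(x) is a multiple of
    sin d, which cancels the denominator of the cotangent. *)
Lemma sin_kernel_half_cot y : sin ((x - y) / 2) != 0 ->
  sin_kernel q y * half_cot x y = diff_kernel y + sin_kernel q x * half_cot x y.
Proof.
move=> s0; have kx : poisson_den q x != 0 by rewrite gt_eqF// poisson_den_gt0.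
have ky : poisson_den q y != 0 by rewrite gt_eqF// poisson_den_gt0.
apply/eqP; rewrite -subr_eq -mulrBl /half_cot /diff_kernel.
set d := (x - y) / 2 in s0 *.
have yE : y = x - (d + d) by rewrite /d; field.
have sd : sin (d + d) = 2 * sin d * cos d by rewrite sinD; ring.
have cd : cos (d + d) = 1 - 2 * sin d ^+ 2 by rewrite cosD -!expr2 cos2sin2; ring.
have SE : sin_kernel q y - sin_kernel q x =
    - (2 * sin d * ((1 + q ^+ 2) * (sin d * sin x + cos d * cos x) - 2 * q * cos d))
      / (poisson_den q x * poisson_den q y).
  have nE : sin y * poisson_den q x - sin x * poisson_den q y =
      - (2 * sin d * ((1 + q ^+ 2) * (sin d * sin x + cos d * cos x) - 2 * q * cos d)).
    have -> : 2 * q * cos d = 2 * q * cos d * (cos x ^+ 2 + sin x ^+ 2)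
      by rewrite cos2Dsin2 mulr1.
    rewrite /poisson_den yE sinB cosB sd cd; ring.
  by rewrite -nE /sin_kernel; field; rewrite kx ky.
rewrite SE.
have -> : x - y = d + d by rewrite /d; field.
rewrite yE cosB sd cd.
have c2 : cos d * cos d = 1 - sin d ^+ 2 by rewrite -cos2sin2 expr2.
apply/eqP.
have -> : (1 + q ^+ 2) * (cos x + (cos x * (1 - 2 * sin d ^+ 2) + sin x * (2 * sin d * cos d))) -
   2 * q * (1 + (1 - 2 * sin d ^+ 2)) = 2 * (((1 + q ^+ 2) * (sin d * sin x + cos d * cos x) -
     2 * q * cos d) * cos d).
  transitivity (2 * ((1 + q ^+ 2) * (sin d * cos d * sin x + cos d * cos d * cos x)
      - 2 * q * (cos d * cos d))); last by ring.
  by rewrite c2; ring.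
by field; rewrite s0 -yE kx ky.
Qed.

Let c := - (poisson_den q x)^-1.
Let alpha := c * ((1 + q ^+ 2) * cos x - 2 * q).
Let beta := c * (1 + q ^+ 2 - 2 * q * cos x).
Let gamma := c * (- (2 * q * sin x)).

Lemma diff_kernelE y : diff_kernel y = (alpha + beta * cos y + gamma * sin y) / poisson_den q y.
Proof. by rewrite /diff_kernel cosB /alpha /beta /gamma /c; ring. Qed.

Lemma continuous_diff_kernel : continuous diff_kernel.
Proof.
have -> : diff_kernel = (fun y => (alpha + beta * cos y + gamma * sin y) / poisson_den q y).
  by apply/funext => y; exact: diff_kernelE.
apply: continuous_div_poisson => // y.
apply: cvgD; first apply: cvgD; first exact: cvg_cst.
- by apply: cvgM; [exact: cvg_cst|exact: continuous_cos].
- by apply: cvgM; [exact: cvg_cst|exact: continuous_sin].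
Qed.

Lemma diff_kernel_bounded : exists M, forall y, `|diff_kernel y| <= M.
Proof.
exists ((`|alpha| + `|beta| + `|gamma|) / (1 - `|q|) ^+ 2) => y; rewrite diff_kernelE.
apply: (div_poisson_bounded q1 (f := fun y => alpha + beta * cos y + gamma * sin y)) => z.
rewrite (le_trans (ler_normD _ _))// lerD//; last by rewrite normrM ler_piMr// sin_max.
by rewrite (le_trans (ler_normD _ _))// lerD2l normrM ler_piMr// cos_max.
Qed.

Lemma cint_diff_kernel : cint diff_kernel = - (2 * pi * cos_kernel q x).
Proof.
have c0 : continuous (fun y => alpha * (cos (0%:R * y) / poisson_den q y)).
  move=> y; apply: cvgM; [exact: cvg_cst|]; apply: continuous_div_poisson => //;
    exact: continuous_cosM.
have c1 : continuous (fun y => beta * (cos (1%:R * y) / poisson_den q y)).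
  move=> y; apply: cvgM; [exact: cvg_cst|]; apply: continuous_div_poisson => //;
    exact: continuous_cosM.
have c2 : continuous (fun y => gamma * (sin (1%:R * y) / poisson_den q y)).
  move=> y; apply: cvgM; [exact: cvg_cst|]; apply: continuous_div_poisson => //;
    exact: continuous_sinM.
have -> : cint diff_kernel = cint (fun y => alpha * (cos (0%:R * y) / poisson_den q y) +
    (beta * (cos (1%:R * y) / poisson_den q y) + gamma * (sin (1%:R * y) / poisson_den q y))).
  by apply: eq_Rintegral => y _; rewrite diff_kernelE mul0r mul1r cos0; ring.
rewrite cintD//; last by move=> y; apply: cvgD; [exact: c1|exact: c2].
rewrite cintD//.
have ck0 : continuous (fun y => cos (0%:R * y) / poisson_den q y)
  by apply: continuous_div_poisson => //; exact: continuous_cosM.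
have ck1 : continuous (fun y => cos (1%:R * y) / poisson_den q y)
  by apply: continuous_div_poisson => //; exact: continuous_cosM.
have ck2 : continuous (fun y => sin (1%:R * y) / poisson_den q y)
  by apply: continuous_div_poisson => //; exact: continuous_sinM.
rewrite !cintZ// !cint_cosn_poisson_den// cint_sinn_poisson_den// /alpha /beta /c /cos_kernel expr0 expr1.
have kx : poisson_den q x != 0 by rewrite gt_eqF// poisson_den_gt0.
have q20 : 1 - q ^+ 2 != 0 by rewrite gt_eqF// one_sub_sqr_gt0.
by field; rewrite kx q20.
Qed.

(** Splits the integral into a regular part and a multiple of the integral
    of the cotangent, whose boundary terms cancel over a symmetric truncation. *)
Lemma Rintegral_sin_kernel_half_cot a b : x < a -> a < b -> b < x + 2 * pi ->
  \int[mu]_(y in `[a, b]) (sin_kernel q y * half_cot x y) =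
  \int[mu]_(y in `[a, b]) diff_kernel y +
  sin_kernel q x * (- (2 * ln (sin ((b - x) / 2))) + 2 * ln (sin ((a - x) / 2))).
Proof.
move=> xa ab bx; rewrite -Rintegral_half_cot//.
have ic : mu.-integrable `[a, b] (EFin \o half_cot x).
  apply: itv_integrable; apply: continuous_in_subspaceT => y.
  rewrite inE/= in_itv/= => /andP[ay yb].
  by apply: continuous_half_cot; apply: sin_half_neq0; lra.
rewrite -RintegralZl// -RintegralD//.
- apply: eq_Rintegral => y; rewrite inE/= in_itv/= => /andP[ay yb].
  by apply: sin_kernel_half_cot; apply: sin_half_neq0; lra.
- by apply: itv_integrable; apply: continuous_subspaceT; exact: continuous_diff_kernel.
- by rewrite (_ : _ \o _ = (fun y => (sin_kernel q x)%:E * (EFin \o half_cot x) y))%E//;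
  exact: integrableZl.
Qed.

End regularised.

Lemma cos_add2pi x : cos (x + 2 * pi) = cos x.
Proof. by rewrite mulr_natl cosD2pi. Qed.

Lemma sin_add2pi x : sin (x + 2 * pi) = sin x.
Proof. by rewrite mulr_natl sinD2pi. Qed.

Lemma poisson_denD2pi q x : poisson_den q (x + 2 * pi) = poisson_den q x.
Proof. by rewrite /poisson_den cos_add2pi. Qed.

Lemma sin_kernelD2pi q x : sin_kernel q (x + 2 * pi) = sin_kernel q x.
Proof. by rewrite /sin_kernel poisson_denD2pi sin_add2pi. Qed.

Lemma cos_kernelD2pi q x : cos_kernel q (x + 2 * pi) = cos_kernel q x.
Proof. by rewrite /cos_kernel poisson_denD2pi cos_add2pi. Qed.

Lemma diff_kernelD2pi q x : diff_kernel q (x + 2 * pi) = diff_kernel q x.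
Proof.
by apply/funext => y; rewrite /diff_kernel poisson_denD2pi cos_add2pi [x + _ - y]addrAC cos_add2pi.
Qed.

Definition trunc_set x e : set R :=
  [set y | circle y /\ forall k : int, e <= `|x - y - 2 * pi * k%:~R|].

Lemma hilbert_truncE (f : R -> R) x e :
  hilbert_trunc f x e = (2 * pi)^-1 * \int[mu]_(y in trunc_set x e) (f y * half_cot x y).
Proof. by []. Qed.

(** Both the truncation set and the kernel are 2 pi-periodic in x; this
    reduces every x to the fundamental period. *)
Lemma hilbert_truncD2pi (f : R -> R) x e :
  hilbert_trunc f (x + 2 * pi) e = hilbert_trunc f x e.
Proof.
rewrite !hilbert_truncE; congr (_ * _).
have -> : trunc_set (x + 2 * pi) e = trunc_set x e.
  apply/seteqP; split => y [cy ey]; split => // k.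
    have <- : x + 2 * pi - y - 2 * pi * (k + 1)%:~R = x - y - 2 * pi * k%:~R.
      by rewrite intrD; ring.
    exact: ey.
  have <- : x - y - 2 * pi * (k - 1)%:~R = x + 2 * pi - y - 2 * pi * k%:~R.
    by rewrite intrB; ring.
  exact: ey.
by apply: eq_Rintegral => y _; rewrite half_cotD2pi.
Qed.

Lemma int_abs_ge1 (k : int) : k != 0 -> 1 <= k%:~R :> R \/ k%:~R <= -1 :> R.
Proof.
case: k => [[//|n]|n] _; [left|right]; first by rewrite ler1n.
by rewrite NegzE mulrNz lerN2 ler1n.
Qed.

Lemma circleP y : circle y <-> - pi <= y <= pi.
Proof. by rewrite /circle/= in_itv. Qed.

(** For small e the truncation only sees the representative y of distance less
    than pi; the translates by 2 pi k with k <> 0 are far away. *)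
Lemma trunc_set_interior x e : 0 < e -> e < pi - x -> e < x + pi ->
  trunc_set x e = `[- pi, x - e] `|` `[x + e, pi].
Proof.
move=> e0 ex ex'; have p0 := @pi_gt0 R.
apply/seteqP; split => y.
  move=> [/circleP/andP[y1 y2]] /(_ 0).
  rewrite mulr0 subr0 => exy.
  have [yx|yx] := leP y x; [left|right]; rewrite /= ?in_itv/=.
    by move: exy; rewrite ger0_norm ?subr_ge0// y1 => ?; lra.
  by move: exy; rewrite ltr0_norm ?subr_lt0// y2 => ?; lra.
move=> yI.
have [y1 y2 exy] : [/\ - pi <= y, y <= pi & e <= `|x - y|].
  case: yI => /=; rewrite in_itv/= => /andP[y1 y2].
    by split; [lra|lra|rewrite ger0_norm; lra].
  by split; [lra|lra|rewrite ler0_norm; lra].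
split=> [|k]; first by apply/circleP; rewrite y1.
have [->|k0] := eqVneq k 0; first by rewrite mulr0 subr0.
have [k1|k1] := int_abs_ge1 k0.
  by rewrite ler0_norm; nra.
by rewrite ger0_norm; nra.
Qed.

(** At x = - pi the excluded arc wraps around and removes a piece at each end
    of the interval. *)
Lemma trunc_set_end e : 0 < e -> e < pi ->
  trunc_set (- pi) e = `[- pi + e, pi - e]%classic.
Proof.
move=> e0 ep; have p0 := @pi_gt0 R.
apply/seteqP; split => y.
  move=> [/circleP/andP[y1 y2]] H.
  have := H 0; rewrite mulr0 subr0 ler0_norm; last by lra.
  have := H (-1); rewrite mulrNz ger0_norm; last by lra.
  by rewrite /= in_itv/=; lra.
rewrite /= in_itv/= => /andP[y1 y2].
split=> [|k]; first by apply/circleP; lra.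
have [->|k0] := eqVneq k 0; first by rewrite mulr0 subr0 ler0_norm; lra.
have [k1|k1] := int_abs_ge1 k0.
  by rewrite ler0_norm; nra.
by rewrite ger0_norm; nra.
Qed.
Lemma cvg_at_right0_le (h : R -> R) l K : 0 < K ->
  (\forall e \near 0^'+, `|h e - l| <= K * e) -> h e @[e --> 0^'+] --> l.
Proof.
move=> K0 hK; apply/cvgrPdist_le => eps eps0; near=> e.
rewrite distrC (@le_trans _ _ (K * e))//; first by near: e; exact: hK.
by rewrite -ler_pdivlMl// mulrC; near: e; apply: nbhs_right_le; rewrite divr_gt0.
Unshelve. all: by end_near. Qed.

Lemma continuous_sin_kernel_half_cot q x y : `|q| < 1 -> sin ((x - y) / 2) != 0 ->
  {for y, continuous (fun y => sin_kernel q y * half_cot x y)}.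
Proof.
move=> q1 s0; apply: cvgM; last exact: continuous_half_cot.
by apply: continuous_div_poisson => //; exact: continuous_sin.
Qed.

(** In both shapes of the truncation set the logarithmic boundary terms
    cancel, and what is left differs from the integral of the regular quotient
    by the integral of a bounded function over a set of length at most 2 e. *)
Lemma hilbert_trunc_sin_kernel_period A q x : `|q| < 1 -> - pi <= x -> x < pi ->
  hilbert_trunc (fun y => A * sin_kernel q y) x e @[e --> 0^'+] --> - (A * cos_kernel q x).
Proof.
move=> q1 xpi xpi'; have p0 := @pi_gt0 R.
have [M hM] := diff_kernel_bounded x q1.
have ch := @continuous_diff_kernel q x q1.
have M0 : 0 <= M by rewrite (le_trans _ (hM 0)).
have near_int : \forall e \near 0^'+, [/\ measurable (trunc_set x e),
    mu.-integrable (trunc_set x e) (EFin \o (fun y => sin_kernel q y * half_cot x y)) &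
    `|\int[mu]_(y in trunc_set x e) (sin_kernel q y * half_cot x y) - - (2 * pi * cos_kernel q x)|
      <= (M * 2 + 1) * e].
  rewrite -cint_diff_kernel//.
  move: xpi; rewrite le_eqVlt => /orP[/eqP xE|xpi].
    near=> e.
    have e0 : 0 < e by near: e; exact: nbhs_right_gt.
    have epi : e < pi by near: e; exact: nbhs_right_lt.
    subst x; rewrite trunc_set_end//; split; first exact: measurable_itv.
      by apply: itv_integrable; apply: continuous_in_subspaceT => y;
        rewrite inE/= in_itv/= => /andP[y1 y2]; apply: continuous_sin_kernel_half_cot => //;
        apply: sin_half_neq0; lra.
    rewrite Rintegral_sin_kernel_half_cot//; last first.
    - lra.
    - lra.
    - lra.
    have -> : (pi - e - - pi) / 2 = - (e / 2) + pi by field.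
    have -> : (- pi + e - - pi) / 2 = e / 2 by field.
    rewrite sinDpi sinN opprK addNr mulr0 addr0.
    rewrite (@Rintegral_itv_split _ (- pi) (- pi + e) pi); [|lra|lra|exact: continuous_subspaceT].
    rewrite (@Rintegral_itv_split _ (- pi + e) (pi - e) pi);
      [|lra|lra|exact: continuous_subspaceT].
    have l1 : - pi <= - pi + e by lra.
    have l2 : pi - e <= pi by lra.
    have := Rintegral_itv_bounded l1 ch hM.
    have := Rintegral_itv_bounded l2 ch hM.
    rewrite !ler_norml => /andP[? ?] /andP[? ?].
    by apply/andP; split; nra.
  near=> e.
  have e0 : 0 < e by near: e; exact: nbhs_right_gt.
  have e1 : e < pi - x by near: e; apply: nbhs_right_lt; lra.
  have e2 : e < x + pi by near: e; apply: nbhs_right_lt; lra.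
  rewrite trunc_set_interior//.
  have intU : mu.-integrable (`[- pi, x - e] `|` `[x + e, pi])
      (EFin \o (fun y => sin_kernel q y * half_cot x y)).
    apply: continuous_compact_integrable.
      by apply: compactU; exact: segment_compact.
    apply: continuous_in_subspaceT => y yI; apply: continuous_sin_kernel_half_cot => //.
    move: yI; rewrite inE => -[] /=; rewrite in_itv/= => /andP[y1 y2];
      last by apply: sin_half_neq0; lra.
    by rewrite gt_eqF//; apply: sin_half_gt0; lra.
  split=> //; first by apply: measurableU; exact: measurable_itv.
  rewrite Rintegral_setU//.
  (* To the left of x the formula is used at x - 2 pi. *)
  - have left_piece : \int[mu]_(y in `[- pi, x - e]) (sin_kernel q y * half_cot x y) =
       \int[mu]_(y in `[- pi, x - e]) diff_kernel q x y +
       sin_kernel q x * (- (2 * ln (sin (e / 2))) + 2 * ln (sin ((pi - x) / 2))).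
      have := @Rintegral_sin_kernel_half_cot q (x - 2 * pi) q1 (- pi) (x - e).
      rewrite -(diff_kernelD2pi q (x - 2 * pi)) -(sin_kernelD2pi q (x - 2 * pi)) subrK.
      have -> : (x - e - (x - 2 * pi)) / 2 = - (e / 2) + pi by field.
      have -> : (- pi - (x - 2 * pi)) / 2 = (pi - x) / 2 by field.
      rewrite sinDpi sinN opprK => <-; [|lra..].
      by apply: eq_Rintegral => y _; rewrite -[in LHS](subrK (2 * pi) x) half_cotD2pi.
    rewrite left_piece (@Rintegral_sin_kernel_half_cot q x q1 (x + e) pi); [|lra..].
    rewrite (_ : (x + e - x) / 2 = e / 2); last by field.
    rewrite (@Rintegral_itv_split _ (- pi) (x - e) pi); [|lra|lra|exact: continuous_subspaceT].
    rewrite (@Rintegral_itv_split _ (x - e) (x + e) pi); [|lra|lra|exact: continuous_subspaceT].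
    have l1 : x - e <= x + e by lra.
    have := Rintegral_itv_bounded l1 ch hM.
    rewrite !ler_norml => /andP[? ?].
    by apply/andP; split; nra.
  - apply/disj_set2P; rewrite -subset0 => y [] /=; rewrite !in_itv/= => /andP[_ y1] /andP[y2 _].
    lra.
have -> : - (A * cos_kernel q x) = (2 * pi)^-1 * (A * - (2 * pi * cos_kernel q x)).
  by rewrite [RHS]mulrCA mulrN mulKf ?mulrN// mulf_neq0// lt0r_neq0.
(* For small e the integrand is integrable over the truncation set, so that
   the factor A can be taken out of the integral. *)
apply: (@cvg_trans _ ((fun e => (2 * pi)^-1 *
    (A * \int[mu]_(y in trunc_set x e) (sin_kernel q y * half_cot x y))) e @[e --> 0^'+])).
  apply: near_eq_cvg; near=> e; rewrite hilbert_truncE; congr (_ * _).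
  have [//|mT intT _] := near near_int e.
  by rewrite -RintegralZl//; apply: eq_Rintegral => y _; rewrite mulrA.
apply: cvgM; first exact: cvg_cst.
apply: cvgM; first exact: cvg_cst.
apply: (@cvg_at_right0_le _ _ (M * 2 + 1)); first by lra.
by apply: filterS near_int => e [].
Unshelve. all: by end_near. Qed.

(** By periodicity in x it is enough to treat the period starting at - pi. *)
Lemma hilbert_trunc_sin_kernel A q x : `|q| < 1 ->
  hilbert_trunc (fun y => A * sin_kernel q y) x e @[e --> 0^'+] --> - (A * cos_kernel q x).
Proof.
move=> q1.
have p0 := @pi_gt0 R.
have pi2 : 0 < 2 * pi :> R by rewrite mulr_gt0.
have shift (P : R -> Prop) : (forall y, P (y + 2 * pi) <-> P y) ->
    (forall y, - pi <= y -> y < pi -> P y) -> forall y, P y.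
  move=> PD Pf y.
  have Pn n z : P (z + 2 * pi * n%:R) <-> P z.
    elim: n z => [|n IH] z; first by rewrite mulr0 addr0.
    by rewrite -(natr1 n) mulrDr mulr1 addrA PD.
  pose m := Num.floor ((y + pi) / (2 * pi)).
  have /andP[m1 m2] := floor_itv ((y + pi) / (2 * pi)).
  rewrite -/m in m1 m2.
  have Pm : P (y - 2 * pi * m%:~R).
    apply: Pf.
      by move: m1; rewrite ler_pdivlMr//; lra.
    by move: m2; rewrite ltr_pdivrMr// intrD; lra.
  case: m Pm {m1 m2} => n; first by move=> H; rewrite -(subrK (2 * pi * n%:R) y) Pn.
  by rewrite NegzE mulrNz mulrN opprK Pn.
move: x; apply: shift => y; last exact: hilbert_trunc_sin_kernel_period.
by rewrite cos_kernelD2pi; under eq_fun do rewrite hilbert_truncD2pi.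
Qed.

End Hilbert.

(** * The three norms of the kernel *)

Section Norms.
Context {R : realType}.
Notation mu := (@lebesgue_measure R).
Notation cint f := (\int[mu]_(x in circle) f x).
Variables (A q : R).
Hypothesis q1 : `|q| < 1.
Let f : R -> R := fun x => A * sin_kernel q x.

Lemma continuous_sin_kernel : continuous (sin_kernel q).
Proof. by apply: continuous_div_poisson => //; exact: continuous_sin. Qed.

Lemma continuous_scaled_sin_kernel : continuous f.
Proof. by move=> x; apply: cvgM; [exact: cvg_cst|exact: continuous_sin_kernel]. Qed.

Lemma L2_norm_sin_kernel : L2_norm f = (Num.sqrt (pi * A ^+ 2 / (1 - q ^+ 2)))%:E.
Proof.
rewrite /L2_norm unlock.
have -> : (\int[mu]_x (`|(EFin \o f \_ circle) x| `^ 2) = \int[mu]_(x in circle) (f x ^+ 2)%:E)%E.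
  rewrite [RHS]integral_mkcond; apply: eq_integral => x _.
  rewrite -[LHS]/((`|(f \_ circle) x|%:E `^ 2)%E) poweR_EFin powR_mulrn// !patchE.
  by case: ifPn => _ /=; [rewrite real_normK ?num_real|rewrite normr0 expr0n].
have cf2 : continuous (fun x => f x ^+ 2).
  by move=> x; apply: cvgM; exact: continuous_scaled_sin_kernel.
have E : cint (fun x => f x ^+ 2) = pi * A ^+ 2 / (1 - q ^+ 2).
  transitivity (cint (fun x => A ^+ 2 * (sin_kernel q x ^+ 2))).
    by apply: eq_Rintegral => x _; rewrite /f exprMn.
  rewrite cintZ ?cint_sin_kernel_sqr//; first by ring.
  by move=> x; apply: cvgM; exact: continuous_sin_kernel.
have -> : (\int[mu]_(x in circle) (f x ^+ 2)%:E = (cint (fun x => f x ^+ 2)%R)%:E)%E.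
  rewrite fineK//; apply: integrable_fin_num; first exact: measurable_itv.
  exact: (circle_integrable cf2).
rewrite E poweR_EFin powR12_sqrt//.
apply: divr_ge0; last exact/ltW/one_sub_sqr_gt0.
by rewrite mulr_ge0 ?pi_ge0 ?sqr_ge0.
Qed.

(** Cauchy-Schwarz for (cos x, sin x) and (2 q, 1 - q^2), a vector of norm
    1 + q^2. *)
Lemma sin_kernel_le x : `|sin_kernel q x| <= (1 - q ^+ 2)^-1.
Proof.
rewrite normrM normfV [`|poisson_den _ _|]gtr0_norm ?poisson_den_gt0//.
rewrite ler_pdivrMr ?poisson_den_gt0// mulrC ler_pdivlMr ?one_sub_sqr_gt0//.
have := cos2Dsin2 x; have := one_sub_sqr_gt0 q1; have := poisson_den_gt0 x q1;
  rewrite /poisson_den.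
set c := cos x; set s := sin x => k0 q2 cs.
have H (t : R) : c ^+ 2 + t ^+ 2 = 1 -> t * (1 - q ^+ 2) <= 1 - 2 * q * c + q ^+ 2.
  move=> ct; set a := 2 * q * c + t * (1 - q ^+ 2).
  suff : a <= 1 + q ^+ 2 by rewrite /a; lra.
  have a2 : a ^+ 2 <= (1 + q ^+ 2) ^+ 2.
    have -> : (1 + q ^+ 2) ^+ 2 = (c ^+ 2 + t ^+ 2) * (1 + q ^+ 2) ^+ 2 by rewrite ct mul1r.
    rewrite -subr_ge0 [X in 0 <= X](_ : _ = (c * (1 - q ^+ 2) - 2 * q * t) ^+ 2) ?sqr_ge0//.
    by rewrite /a; ring.
  rewrite (le_trans (ler_norm a))// -[leRHS]ger0_norm; last by rewrite addr_ge0// sqr_ge0.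
  by rewrite -ler_sqr ?nnegrE// !real_normK ?num_real.
have [s0|s0] := ger0P s; first exact: H.
by apply: H; rewrite sqrrN.
Qed.

(** The equality case of Cauchy-Schwarz: cos x = 2 q / (1 + q^2). *)
Lemma sin_kernel_max : exists2 x, - pi < x < pi & sin_kernel q x = (1 - q ^+ 2)^-1.
Proof.
have q2 := one_sub_sqr_gt0 q1.
have q2' : 0 < 1 + q ^+ 2 by rewrite ltr_pwDl// sqr_ge0.
have cb : -1 < 2 * q / (1 + q ^+ 2) < 1.
  move: q1; rewrite ltr_norml => /andP[? ?].
  rewrite ltr_pdivlMr// ltr_pdivrMr//; apply/andP; split; nra.
have cb' : -1 <= 2 * q / (1 + q ^+ 2) <= 1 by move/andP : cb => [/ltW-> /ltW->].
exists (acos (2 * q / (1 + q ^+ 2))).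
  have := acos_ltpi (x := 2 * q / (1 + q ^+ 2)); have := acos_ge0 cb'.
  move/andP : cb => [-> /ltW->] /= a0 /(_ isT) ->; rewrite andbT.
  by rewrite (lt_le_trans _ a0)// oppr_lt0 pi_gt0.
rewrite /sin_kernel /poisson_den acosK ?in_itv// sin_acos//.
have -> : 1 - (2 * q / (1 + q ^+ 2)) ^+ 2 = ((1 - q ^+ 2) / (1 + q ^+ 2)) ^+ 2.
  by field; rewrite gt_eqF.
rewrite sqrtr_sqr ger0_norm ?divr_ge0 ?ltW//.
field; rewrite !gt_eqF//=.
rewrite (_ : _ + _ = (1 - q ^+ 2) ^+ 2); last by ring.
by rewrite exprn_gt0.
Qed.

(** By continuity a value above the essential supremum would be exceeded on a
    ball, which is not negligible. *)
Lemma Linf_norm_continuous (g : R -> R) L : continuous g -> (forall x, `|g x| <= L) ->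
  (exists2 x, - pi < x < pi & `|g x| = L) -> Linf_norm g = L%:E.
Proof.
move=> cg gL [x0 /andP[x1 x2] gx0]; rewrite /Linf_norm unlock.
have L0 : 0 <= L by rewrite -gx0.
have muT : (0 < mu [set: R])%E.
  apply: (@lt_le_trans _ _ (mu `[0, 1]%classic)).
    by rewrite lebesgue_measure_itv/= lte_fin ltr01 oppr0 adde0 lte_fin.
  by apply: le_measure => //; rewrite inE//; exact: measurable_itv.
rewrite muT; apply/eqP; rewrite eq_le; apply/andP; split.
  apply/ess_supP; apply: nearW => x /=; rewrite lee_fin patchE.
  by case: ifPn => _; rewrite ?normr0.
rewrite leNgt; apply/negP => lt.
have [M [esM ML]] : exists M : R, (ess_sup mu (abse \o (EFin \o g \_ circle)) <= M%:E)%E /\ M < L.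
  move: lt; set es := ess_sup _ _.
  case: es => [r|//|]; last by exists (L - 1); rewrite leNye ltrBlDr ltrDl ltr01.
  by rewrite lte_fin => rL; exists r.
have [N [mN N0 sub]] : \forall x \ae mu, ((abse \o (EFin \o g \_ circle)) x <= M%:E)%E.
  exact/ess_supP.
have : \forall x \near x0, M < `|g x| /\ - pi < x < pi.
  near=> x; split.
    by near: x; apply: (cvgr_gt `|g x0|); [apply: cvg_norm; exact: cg|rewrite gx0].
  by apply/andP; split; near: x; [exact: lt_nbhsr|exact: lt_nbhsl].
move=> /nbhs_ballP[r /= r0 br].
have : (mu (ball x0 r) <= mu N)%E.
  apply: le_measure; rewrite ?inE//; first by rewrite ball_itv; exact: measurable_itv.
  move=> x /br[Mg /andP[x3 x4]]; apply: sub => /=; apply/negP.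
  by rewrite lee_fin -ltNge patchE mem_set//; apply/circleP; rewrite !ltW.
by rewrite N0 (lebesgue_measure_ball _ (ltW r0)) leNgt lte_fin mulrn_wgt0.
Unshelve. all: by end_near. Qed.

Lemma Linf_norm_sin_kernel : Linf_norm f = (`|A| / (1 - q ^+ 2))%:E.
Proof.
apply: Linf_norm_continuous; first exact: continuous_scaled_sin_kernel.
  by move=> x; rewrite normrM ler_wpM2l// sin_kernel_le.
have [x xb xE] := sin_kernel_max; exists x => //.
by rewrite normrM xE [`|_^-1|]ger0_norm// invr_ge0 ltW// one_sub_sqr_gt0.
Qed.

(** The cosine part vanishes by oddness of S_q, and the sine part is the
    coefficient of the generating function. *)
Lemma fourier_coef_sin_kernel k : ComplexField.Normc.normc (fourier_coef f k) =
  if k == 0 then 0 else `|A| / 2 * `|q| ^+ `|k|.-1.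
Proof.
have ccosm (j : int) : cint (fun x => f x * cos (j%:~R * x)) = 0.
  transitivity (cint (fun x => A * (sin_kernel q x * cos (`|j|%N%:R * x)))).
    apply: eq_Rintegral => x _; rewrite /f -mulrA; congr (A * (_ * _)).
    by case: j => n //; rewrite NegzE mulrNz mulNr cosN.
  rewrite cintZ ?cint_sin_kernel_cos ?mulr0//.
  by move=> x; apply: cvgM; [exact: continuous_sin_kernel|exact: continuous_cosM].
have csk n : continuous (fun x => sin_kernel q x * sin (n%:R * x)).
  by move=> x; apply: cvgM; [exact: continuous_sin_kernel|exact: continuous_sinM].
have p0 : (pi : R) != 0 by rewrite gt_eqF// pi_gt0.
have sinm n : cint (fun x => f x * sin (n.+1%:R * x)) = A * (pi * q ^+ n).
  by under eq_Rintegral do rewrite /f -mulrA; rewrite cintZ// cint_sin_kernel_sin.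
have norm_half n : `|(2 * pi)^-1 * (A * (pi * q ^+ n))| = `|A| / 2 * `|q| ^+ n.
  rewrite -normrX -[2 in RHS]gtr0_norm// -normfV -!normrM; congr (`|_|).
  move: p0; generalize (pi : R) => P P0; by field.
rewrite /fourier_coef /= ccosm mulr0 expr0n/= add0r sqrrN sqrtr_sqr.
case: k => [[|n]|n] /=.
- rewrite (_ : (fun x => _) = cst 0) ?cint_cst ?mul0r ?mulr0 ?normr0//.
  by apply/funext => x; rewrite mul0r sin0 mulr0.
- by rewrite -norm_half -sinm.
- rewrite -norm_half -sinm -[LHS]normrN -mulrN; congr (`|_ * _|).
  rewrite -mulN1r -cintZ; last first.
    move=> x; apply: cvgM; first exact: continuous_scaled_sin_kernel.
    by rewrite NegzE; exact: continuous_sinM.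
  by apply: eq_Rintegral => x _; rewrite NegzE mulrNz mulN1r mulNr sinN mulrN opprK.
Qed.

Lemma esum_geometric (c z : R) : 0 <= c -> 0 <= z < 1 ->
  \esum_(n in [set: nat]) (c * z ^+ n)%:E = (c / (1 - z))%:E.
Proof.
move=> c0 /andP[z0 z1].
have cvs : series (geometric c z) @ \oo --> c / (1 - z).
  by apply: cvg_geometric_series; rewrite ger0_norm.
rewrite -nneseries_esumT; last by move=> n; rewrite lee_fin mulr_ge0// exprn_ge0.
apply/cvg_lim => //; apply: cvg_EFin => //.
  by apply: nearW => n; rewrite sumEFin.
rewrite (_ : fine \o _ = series (geometric c z))//.
by apply/funext => n /=; rewrite sumEFin.
Qed.

(** The integers split into 0, the positive and the negative ones; the last two
    contribute the same geometric series. *)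
Lemma wiener_norm_sin_kernel : wiener_norm f = (`|A| / (1 - `|q|))%:E.
Proof.
rewrite /wiener_norm.
set a := fun k : int => _.
have a0 k : (0 <= a k)%E.
  by rewrite /a lee_fin; case: fourier_coef => u v; rewrite sqrtr_ge0.
have az : a 0 = 0%E by rewrite /a fourier_coef_sin_kernel.
have ap n : a (Posz n.+1) = (`|A| / 2 * `|q| ^+ n)%:E by rewrite /a fourier_coef_sin_kernel.
have an n : a (Negz n) = (`|A| / 2 * `|q| ^+ n)%:E by rewrite /a fourier_coef_sin_kernel.
clearbody a.
have g0 : 0 <= `|A| / 2 by rewrite divr_ge0.
have qb : 0 <= `|q| < 1 by rewrite normr_ge0 q1.
rewrite (esumID [set (0 : int)]) ?setTI; last by move=> k _; exact: a0.
rewrite esum_set1// az add0e (esumID [set k : int | 0 < k]); last by move=> k _; exact: a0.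
have -> : ~` [set 0 : int] `&` [set k | 0 < k] = (fun n => Posz n.+1) @` setT.
  apply/seteqP; split => [k [_ /=]|_ [n _ <-]//].
  by case: k => [[|n]|n]// _; exists n.
have -> : ~` [set 0 : int] `&` ~` [set k | 0 < k] = Negz @` setT.
  apply/seteqP; split => [k [/= k0 k1]|_ [n _ <-]//].
  by move: k0 k1; case: k => [[|n]|n]// _ _; exists n.
rewrite !esum_image; [|by move=> m n _ _ []..].
have -> : \esum_(n in [set: nat]) a (Posz n.+1) = (`|A| / 2 / (1 - `|q|))%:E.
  by rewrite -esum_geometric//; apply: eq_esum => n _.
have -> : \esum_(n in [set: nat]) a (Negz n) = (`|A| / 2 / (1 - `|q|))%:E.
  by rewrite -esum_geometric//; apply: eq_esum => n _.
by rewrite -EFinD; congr EFin; field; rewrite subr_eq0 eq_sym lt_eqF.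
Qed.

End Norms.

(** * The solution as a moving kernel *)

(** Identifies the L2 norm computed from the kernel with its expression in
    v_c = (1 - p) / (1 + p). *)
Lemma sqrt_area (R : rcfType) (P a p : R) : 0 <= P -> 0 < 1 + p -> 0 < 1 - p ->
  Num.sqrt (P * a ^+ 2 / (1 - p ^+ 2)) = 2 * Num.sqrt P * (`|a| / (1 + p) ^+ 2) /
    (Num.sqrt ((1 - p) / (1 + p)) * (1 + (1 - p) / (1 + p))).
Proof.
move=> P0 p1 p2.
have vg : 0 < (1 - p) / (1 + p) by rewrite divr_gt0.
have sv := sqr_sqrtr (ltW vg).
have sq : Num.sqrt ((1 - p) / (1 + p)) != 0 by rewrite gt_eqF// sqrtr_gt0.
have -> : 1 + (1 - p) / (1 + p) = 2 / (1 + p) by field; rewrite gt_eqF.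
have -> : P * a ^+ 2 / (1 - p ^+ 2) =
   (Num.sqrt P * `|a| / (Num.sqrt ((1 - p) / (1 + p)) * (1 + p))) ^+ 2.
  rewrite [RHS]expr_div_n !exprMn sqr_sqrtr// sv real_normK ?num_real//.
  have -> : 1 - p ^+ 2 = (1 + p) * (1 - p) by ring.
  by field; rewrite !gt_eqF.
rewrite sqrtr_sqr ger0_norm; last first.
  by rewrite divr_ge0 ?mulr_ge0 ?sqrtr_ge0// ltW.
by field; rewrite sq gt_eqF.
Qed.

Section Profile.
Context {R : realType}.
Variables (nu v0 w0 : R).
Hypotheses (nu_gt0 : 0 < nu) (v0_gt0 : 0 < v0).
Notation v := (vc nu v0 w0).
Notation w := (omega_m1 nu v0 w0).
Notation om := (omega nu v0 w0).

(** The parameter q of the kernel, equal to (1 - v_c) / (1 + v_c).  Written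
    through the denominator of v_c it is defined, and affine in exp (- nu t), even
    when v_c is infinite. *)
Definition pole (t : R) : R := 2 * vc_den nu v0 w0 t / (nu * (1 + v0) ^+ 2) - 1.

(** The factor A of the kernel, equal to 4 omega_{-1} / (1 + v_c)^2. *)
Definition amplitude (t : R) : R := 4 * w0 * expR (- (nu * t)) / (1 + v0) ^+ 2.

Let nz : nu != 0. Proof. by rewrite gt_eqF. Qed.
Let vz : 1 + v0 != 0. Proof. by rewrite gt_eqF// ltr_pwDl// ltW. Qed.

Lemma vc_denE t : vc_den nu v0 w0 t = nu * (1 + v0) ^+ 2 * (1 + pole t) / 2.
Proof. by rewrite /pole; field; rewrite nz vz. Qed.

(** The numerator and the denominator of v_c have the constant sum nu (1 + v0)^2. *)
Lemma vc_numE t : vc_num nu v0 w0 t = nu * (1 + v0) ^+ 2 * (1 - pole t) / 2.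
Proof. by rewrite /pole /vc_num /vc_den; field; rewrite nz vz. Qed.

Let cz : nu * (1 + v0) ^+ 2 / 2 > 0.
Proof. by rewrite divr_gt0// mulr_gt0// exprn_gt0// ltr_pwDl// ltW. Qed.

Lemma vc_den_eq0 t : (vc_den nu v0 w0 t == 0) = (1 + pole t == 0).
Proof. by rewrite vc_denE mulrAC mulf_eq0 gt_eqF. Qed.

Lemma vcE t : 1 + pole t != 0 -> v t = (1 - pole t) / (1 + pole t).
Proof. by move=> h; rewrite /vc vc_numE vc_denE; field; rewrite ?nz ?vz ?h. Qed.

Lemma vc_pos_finiteP t : vc_pos_finite nu v0 w0 t <-> `|pole t| < 1.
Proof.
rewrite /vc_pos_finite vc_den_eq0; split.
  case=> h; rewrite vcE// ltr_norml => vp.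
  have [p|p] := ltP 0 (1 + pole t).
    by move: vp; rewrite pmulr_lgt0 ?invr_gt0// => vp; apply/andP; split; lra.
  have p' : 1 + pole t < 0 by rewrite lt_neqAle h.
  by move: vp; rewrite nmulr_lgt0 ?invr_lt0// => vp; lra.
rewrite ltr_norml => /andP[h1 h2].
have p : 0 < 1 + pole t by lra.
by rewrite gt_eqF// vcE ?gt_eqF// divr_gt0//; lra.
Qed.

Lemma is_derive_decay (t : R) : is_derive t 1 (fun t => expR (- (nu * t))) (- nu * expR (- (nu * t))).
Proof.
have -> : (fun t => expR (- (nu * t))) = @expR R \o (fun t => - (nu * t)) by [].
by apply: is_derive_eq; rewrite /GRing.scale/=; ring.
Qed.

Lemma is_derive_vc_den (t : R) : is_derive t 1 (vc_den nu v0 w0) (- (nu * w0 * expR (- (nu * t)))).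
Proof.
have de := is_derive_decay t.
by rewrite /vc_den; apply: is_derive_eq; rewrite /GRing.scale/=; ring.
Qed.

Lemma is_derive_vc_num (t : R) : is_derive t 1 (vc_num nu v0 w0) (nu * w0 * expR (- (nu * t))).
Proof.
have de := is_derive_decay t.
by rewrite /vc_num; apply: is_derive_eq; rewrite /GRing.scale/=; ring.
Qed.

Lemma is_derive_pole (t : R) : is_derive t 1 pole (- (amplitude t / 2)).
Proof.
have dd := is_derive_vc_den t.
rewrite /pole; apply: is_derive_eq; rewrite /GRing.scale/= /amplitude.
by field; rewrite nz vz.
Qed.

Lemma is_derive_amplitude (t : R) : is_derive t 1 amplitude (- (nu * amplitude t)).
Proof.
have de := is_derive_decay t.
rewrite /amplitude; apply: is_derive_eq; rewrite /GRing.scale/=.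
by field.
Qed.

Lemma omega_m1E t : 1 + pole t != 0 -> w t = amplitude t / (1 + pole t) ^+ 2.
Proof.
move=> h; have dn := is_derive_vc_num t; have dd := is_derive_vc_den t.
have d0 : vc_den nu v0 w0 t != 0 by rewrite vc_den_eq0.
have dV := is_deriveV d0 dd.
have dv : is_derive t 1 (vc nu v0 w0) (amplitude t / (1 + pole t) ^+ 2).
  rewrite /vc; apply: is_derive_eq; rewrite /GRing.scale/=.
  rewrite -[_ ^- 2]/((_ ^+ 2)^-1) vc_numE vc_denE /amplitude.
  by field; rewrite ?nz ?vz ?h.
by rewrite /omega_m1 derive1E; exact: derive_val.
Qed.

(** The constant subtracted in omega_- is purely imaginary and drops out of the
    real part; the rest is a rational function of tan (x / 2) that the
    half-angle formulas turn into the kernel.  Where cos (x / 2) = 0 both sides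
    vanish. *)
Lemma omegaE x t : `|pole t| < 1 -> om x t = amplitude t * sin_kernel (pole t) x.
Proof.
move=> h; have p : 0 < 1 + pole t by move: h; rewrite ltr_norml => /andP[]; lra.
have p0 : 1 + pole t != 0 by rewrite gt_eqF.
have k0 := poisson_den_gt0 x h.
have ReM (a : R) (z : R[i]) : complex.Re (real_complex R a * z) = a * complex.Re z.
  by case: z => b c /=; rewrite mul0r subr0.
rewrite /omega /omegaC /omega_plus.
have -> : forall z : R[i], complex.Re (z + conjc z) = 2 * complex.Re z.
  by case=> a b /=; ring.
rewrite /omega_minus ReM.
have -> : forall z1 z2 : R[i], complex.Re (z1 - z2) = complex.Re z1 - complex.Re z2.
  by case=> a b [c d].
have -> : - 'i%C - 'i%C * real_complex R (v t) = Complex 0 (- (1 + v t)).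
  by apply/eqP; rewrite eq_complex /=; apply/andP; split; apply/eqP; ring.
rewrite [complex.Re (Complex 0 _)^-1]/= mul0r subr0.
have xE : x = x / 2 + x / 2 by field.
have sx : sin x = 2 * sin (x / 2) * cos (x / 2) by rewrite {1}xE sinD; ring.
have cx : cos x = cos (x / 2) ^+ 2 - sin (x / 2) ^+ 2 by rewrite {1}xE cosD; ring.
case: eqP => [c0|/eqP c0].
  by rewrite /= /sin_kernel sx c0; ring.
have -> : real_complex R (tan (x / 2)) - 'i%C * real_complex R (v t)
  = Complex (tan (x / 2)) (- v t).
  by apply/eqP; rewrite eq_complex /=; apply/andP; split; apply/eqP; ring.
rewrite /= omega_m1E// vcE// /sin_kernel sx /tan.
have kE : poisson_den (pole t) x = (1 - pole t) ^+ 2 * cos (x / 2) ^+ 2 + (1 + pole t) ^+ 2 *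
  sin (x / 2) ^+ 2.
  by rewrite /poisson_den cx -[X in X - _](cos2Dsin2 (x / 2)) -[X in _ + X]mul1r -[X in _ + X *
    _](cos2Dsin2 (x / 2)); ring.
move: k0; rewrite kE => k0.
field; rewrite p0 c0 andbT /=.
by rewrite !exprMn gt_eqF.
Qed.

(** Since d S_q / dq = 2 S_q C_q, the equations q' = - A / 2 and A' = - nu A give
    the right-hand side of the equation with H (A S_q) = - A C_q. *)
Lemma is_derive_profile x t : `|pole t| < 1 ->
  is_derive t 1 (fun s => amplitude s * sin_kernel (pole s) x)
    (amplitude t * sin_kernel (pole t) x * (- (amplitude t * cos_kernel (pole t) x)) - nu *
      (amplitude t * sin_kernel (pole t) x)).
Proof.
move=> h; have k0 : poisson_den (pole t) x != 0 by rewrite gt_eqF// poisson_den_gt0.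
have dp := is_derive_pole t; have da := is_derive_amplitude t.
have dk : is_derive t 1 (fun s => poisson_den (pole s) x) (amplitude t * (cos x - pole t)).
  by rewrite /poisson_den; apply: is_derive_eq; rewrite /GRing.scale/=; field.
have dV := @is_deriveV _ (fun s => poisson_den (pole s) x) t _ _ k0 dk.
rewrite /sin_kernel /cos_kernel; apply: is_derive_eq; rewrite /GRing.scale/=.
by field; rewrite k0.
Qed.

Lemma continuous_pole : continuous pole.
Proof.
move=> t; apply: differentiable_continuous; apply/derivable1_diffP.
by have [] := is_derive_pole t.
Qed.

Lemma continuous_amplitude : continuous amplitude.
Proof.
move=> t; apply: differentiable_continuous; apply/derivable1_diffP.
by have [] := is_derive_amplitude t.
Qed.

Lemma continuous_profile (z : R * R) : `|pole z.2| < 1 ->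
  {for z, continuous (fun z : R * R => amplitude z.2 * sin_kernel (pole z.2) z.1)}.
Proof.
move=> h.
have c1 : {for z, continuous (fun z : R * R => z.1)} by exact: cvg_fst.
have c2 : {for z, continuous (fun z : R * R => z.2)} by exact: cvg_snd.
have cp : {for z, continuous (fun z : R * R => pole z.2)}.
  by apply: (continuous_comp c2); exact: continuous_pole.
have cc : {for z, continuous (fun z : R * R => cos z.1)}.
  by apply: (continuous_comp c1); exact: continuous_cos.
apply: cvgM; first by apply: (continuous_comp c2); exact: continuous_amplitude.
apply: cvgM; first by apply: (continuous_comp c1); exact: continuous_sin.
apply: cvgV; first by rewrite gt_eqF// poisson_den_gt0.
apply: cvgD; last by apply: cvgM.
apply: cvgB; first exact: cvg_cst.
apply: cvgM => //; apply: cvgM => //; exact: cvg_cst.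
Qed.

Lemma omega_funE t : `|pole t| < 1 -> om^~ t = (fun x => amplitude t * sin_kernel (pole t) x).
Proof. by move=> h; apply/funext => x; exact: omegaE. Qed.

Lemma omega_is_solution (T : \bar R) :
  (forall t, 0 <= t -> (t%:E < T)%E -> `|pole t| < 1) -> is_solution nu T om.
Proof.
move=> h.
have hil x t : 0 < t -> (t%:E < T)%E ->
    hilbert_trunc (om^~ t) x e @[e --> 0^'+] --> - (amplitude t * cos_kernel (pole t) x).
  by move=> t0 tT; rewrite omega_funE ?h ?ltW//; apply: hilbert_trunc_sin_kernel; rewrite h ?ltW.
split.
- pose F := (fun z : R * R => amplitude z.2 * sin_kernel (pole z.2) z.1).
  pose S := [set z : R * R | 0 <= z.2 /\ (z.2%:E < T)%E].
  have cF : {within S, continuous F}.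
    apply: continuous_in_subspaceT => z; rewrite inE => -[z0 zT].
    by apply: continuous_profile; exact: h.
  apply: subspace_eq_continuous cF.
  move=> z; rewrite inE => -[z0 zT].
  by rewrite -[RHS]/(om z.1 z.2) -[LHS]/(F z) omegaE ?h.
- by move=> x t t0 tT; rewrite !omegaE ?h// sin_kernelD2pi.
- move=> t t0 tT; rewrite omega_funE ?h//.
  have q1 := h _ t0 tT.
  rewrite cintZ; last exact: continuous_sin_kernel.
  rewrite -[RHS](mulr0 (amplitude t)) -[in RHS](cint_sin_kernel_cos q1 0).
  by congr (_ * _); apply: eq_Rintegral => x _; rewrite mul0r cos0 mulr1.
- by move=> x t t0 tT; apply/cvg_ex; eexists; exact: hil.
- move=> x t t0 tT.
  have q1 := h _ (ltW t0) tT.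
  have -> : hilbert (om^~ t) x = - (amplitude t * cos_kernel (pole t) x)
    by apply/cvg_lim => //; exact: hil.
  rewrite (omegaE x q1).
  have dF := is_derive_profile x q1.
  apply: (@near_eq_is_derive _ _ _ (fun r => amplitude r * sin_kernel (pole r) x) (om x) _ _ _ _ dF).
  have [T' tT' TT'] : exists2 T' : R, t < T' & (T'%:E <= T)%E.
    move: tT; case: (T) => [r|_|//]; last by exists (t + 1); rewrite ?leey ?ltrDl.
    by rewrite lte_fin => tr; exists r.
  near=> s; rewrite omegaE//; apply: h.
    by apply/ltW; near: s; exact: lt_nbhsr.
  by apply: lt_le_trans TT'; rewrite lte_fin; near: s; exact: lt_nbhsl.
Unshelve. all: by end_near. Qed.

Section norm_values.
Variable t : R.
Hypothesis h : `|pole t| < 1.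

Let p1 : 0 < 1 + pole t.
Proof. by move: h; rewrite ltr_norml => /andP[]; lra. Qed.
Let p2 : 0 < 1 - pole t.
Proof. by move: h; rewrite ltr_norml => /andP[]; lra. Qed.

Lemma Im_omegaC x : complex.Im (omegaC nu v0 w0 x t) = 0.
Proof. by rewrite /omegaC /omega_plus; case: omega_minus => a b /=; rewrite subrr. Qed.

Lemma norm_omega_m1 : `|w t| = `|amplitude t| / (1 + pole t) ^+ 2.
Proof.
by rewrite omega_m1E ?gt_eqF// normrM normfV [`|_ ^+ 2|]ger0_norm// sqr_ge0.
Qed.

Lemma Linf_norm_omega : Linf_norm (om^~ t) = (`|w t| / v t)%:E.
Proof.
rewrite omega_funE// Linf_norm_sin_kernel// norm_omega_m1 vcE ?gt_eqF//; congr EFin.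
have -> : 1 - pole t ^+ 2 = (1 + pole t) * (1 - pole t) by ring.
by field; rewrite !gt_eqF.
Qed.

Lemma L2_norm_omega : L2_norm (om^~ t) =
  (2 * Num.sqrt pi * `|w t| / (Num.sqrt (v t) * (1 + v t)))%:E.
Proof.
rewrite omega_funE// L2_norm_sin_kernel//; congr EFin.
rewrite norm_omega_m1 vcE ?gt_eqF//.
by apply: sqrt_area; rewrite ?pi_ge0.
Qed.

Lemma wiener_norm_omega : wiener_norm (om^~ t) =
  (`|w t| / v t * (`|1 - v t| / (1 + v t) + 1))%:E.
Proof.
rewrite omega_funE// wiener_norm_sin_kernel//; congr EFin.
rewrite norm_omega_m1 vcE ?gt_eqF//.
have -> : `|1 - (1 - pole t) / (1 + pole t)| = 2 * `|pole t| / (1 + pole t).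
  rewrite -[2 in RHS]ger0_norm// -[1 + pole t in RHS]ger0_norm ?ltW// -normfV -!normrM.
  by congr (`|_|); field; rewrite gt_eqF.
have q20 : 1 - `|pole t| != 0 by rewrite subr_eq0 eq_sym lt_eqF.
have q21 : 1 + `|pole t| != 0 by rewrite gt_eqF// ltr_pwDl.
have E : (1 + pole t) * (1 - pole t) = (1 + `|pole t|) * (1 - `|pole t|).
  transitivity (1 - pole t ^+ 2); first by ring.
  by rewrite -(real_normK (num_real (pole t))); ring.
have -> : 1 + (1 - pole t) / (1 + pole t) = 2 / (1 + pole t) by field; rewrite gt_eqF.
have -> : `|amplitude t| / (1 + pole t) ^+ 2 / ((1 - pole t) / (1 + pole t)) =
    `|amplitude t| / ((1 + pole t) * (1 - pole t)) by field; rewrite !gt_eqF.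
by rewrite E; field; rewrite q20 q21 gt_eqF.
Qed.
End norm_values.
End Profile.

(** * Time decay and the borderline norms *)

Section Decay.
Context {R : realType}.
Variables (nu v0 w0 : R).
Hypotheses (nu_gt0 : 0 < nu) (v0_gt0 : 0 < v0).
Notation v := (vc nu v0 w0).
Notation w := (omega_m1 nu v0 w0).
Notation om := (omega nu v0 w0).
Notation pole := (pole nu v0 w0).
Notation amplitude := (amplitude nu v0 w0).
Notation decay t := (expR (- (nu * t))).

Let nz : nu != 0. Proof. by rewrite gt_eqF. Qed.
Let v1_gt0 : 0 < 1 + v0. Proof. by rewrite ltr_pwDl// ltW. Qed.
Let vz : 1 + v0 != 0. Proof. by rewrite gt_eqF. Qed.

Lemma decay0 : decay 0 = 1.
Proof. by rewrite mulr0 oppr0 expR0. Qed.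

Lemma decay_le1 t : 0 <= t -> decay t <= 1.
Proof. by move=> t0; rewrite -expR0 ler_expR oppr_le0 mulr_ge0// ltW. Qed.

Lemma decay_lt s t : s < t -> decay t < decay s.
Proof. by move=> st; rewrite ltr_expR ltrN2 ltr_pM2l. Qed.

Lemma cvg_decay : decay t @[t --> +oo] --> (0 : R).
Proof.
apply: (@cvg_comp _ _ _ (fun t => nu * t) (fun x => expR (- x)) _ +oo); last exact: cvgr_expR.
by apply: gt0_cvgMry => //; exact: cvg_id.
Qed.

Lemma pole_bounded t : 0 < vc_num nu v0 w0 t -> 0 < vc_den nu v0 w0 t -> `|pole t| < 1.
Proof.
move=> n0 d0; apply/(vc_pos_finiteP _ nu_gt0 v0_gt0).
by split; rewrite ?gt_eqF// divr_gt0.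
Qed.

Lemma pole_at0 : pole 0 = (1 - v0) / (1 + v0).
Proof. by rewrite /pole /vc_den decay0; field; rewrite nz vz. Qed.

Lemma pole_bounded_at0 : `|pole 0| < 1.
Proof.
have v0p := v0_gt0; rewrite pole_at0 ltr_norml ltr_pdivrMr// ltr_pdivlMr//.
by apply/andP; split; lra.
Qed.

Lemma vc_at0 : v 0 = v0.
Proof.
rewrite vcE// pole_at0; first by field; rewrite vz /= (_ : _ + _ = 2) //; ring.
by rewrite (_ : _ + _ = 2 / (1 + v0)) ?mulf_neq0 ?invr_eq0//; field.
Qed.

Lemma omega_m1_at0 : w 0 = w0.
Proof.
rewrite omega_m1E// /amplitude ?decay0 ?pole_at0; first by field;
  rewrite vz /= (_ : _ + _ = 2) //; ring.
by rewrite (_ : _ + _ = 2 / (1 + v0)) ?mulf_neq0 ?invr_eq0//; field.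
Qed.

(** Numerator and denominator of v_c are convex combinations, with weights
    1 - e and e for e = exp (- nu t), of their nonnegative limits and of their
    positive initial values. *)
Lemma pole_bounded_all t : - nu * v0 * (1 + v0) <= w0 <= nu * (1 + v0) -> 0 <= t ->
  `|pole t| < 1.
Proof.
move=> /andP[h1 h2] t0; have := decay_le1 t0; have := expR_gt0 (- (nu * t)) => e0 e1.
apply: pole_bounded; rewrite /vc_num /vc_den; set e := decay t in e0 e1 *.
  have k0 : 0 < nu * v0 * (1 + v0) by rewrite !mulr_gt0.
  have -> : w0 * (1 - e) + nu * v0 * (1 + v0) =
    (w0 + nu * v0 * (1 + v0)) * (1 - e) + nu * v0 * (1 + v0) * e by ring.
  by apply: ltr_wpDl; [apply: mulr_ge0; lra|exact: mulr_gt0].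
have k0 : 0 < nu * (1 + v0) by rewrite !mulr_gt0.
have -> : - w0 * (1 - e) + nu * (1 + v0) =
  (nu * (1 + v0) - w0) * (1 - e) + nu * (1 + v0) * e by ring.
by apply: ltr_wpDl; [apply: mulr_ge0; lra|exact: mulr_gt0].
Qed.

Lemma Linf_norm_profile t : `|pole t| < 1 -> Linf_norm (om^~ t)
  = (`|amplitude t| / (1 - pole t ^+ 2))%:E.
Proof. by move=> h; rewrite omega_funE// Linf_norm_sin_kernel. Qed.

Lemma L2_norm_profile t : `|pole t| < 1 ->
  L2_norm (om^~ t) = (Num.sqrt (pi * amplitude t ^+ 2 / (1 - pole t ^+ 2)))%:E.
Proof. by move=> h; rewrite omega_funE// L2_norm_sin_kernel. Qed.

Lemma wiener_norm_profile t : `|pole t| < 1 ->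
  wiener_norm (om^~ t) = (`|amplitude t| / (1 - `|pole t|))%:E.
Proof. by move=> h; rewrite omega_funE// wiener_norm_sin_kernel. Qed.

Lemma cvg_EFin_comp (F : set_system R) (g : R -> R) l : Filter F ->
  g @ F --> l -> (EFin \o g) @ F --> l%:E.
Proof. by move=> FF gl; apply: cvg_EFin => //; exact: nearW. Qed.

Section borderline.
Variables (s k : R).
Hypotheses (s2 : s ^+ 2 = 1) (k_gt0 : 0 < k)
  (sp : forall t, s * pole t = 1 - k * decay t)
  (am : forall t, `|amplitude t| = 2 * nu * k * decay t)
  (pb : forall t, 0 <= t -> `|pole t| < 1).

Let one_sub_pole2 t : 1 - pole t ^+ 2 = k * decay t * (2 - k * decay t).
Proof.
have -> : pole t ^+ 2 = (s * pole t) ^+ 2 by rewrite exprMn s2 mul1r.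
by rewrite sp; ring.
Qed.

Let cvg_two_sub : 2 - k * decay t @[t --> +oo] --> (2 : R).
Proof.
rewrite -[X in _ --> X]subr0 -[X in _ - X](mulr0 k).
by apply: cvgB; [exact: cvg_cst|apply: cvgM; [exact: cvg_cst|exact: cvg_decay]].
Qed.

Let two_sub_gt0 t : 0 <= t -> 0 < 2 - k * decay t.
Proof.
move=> t0; have := pb t0; rewrite ltr_norml => /andP[h1 h2].
have /eqP := s2; rewrite sqrf_eq1 => /orP[] /eqP sE; have := sp t; rewrite sE; lra.
Qed.

(** With |A| = 2 nu (1 - s q) and 1 - q^2 = (1 - s q) (1 + s q) the norm is
    2 nu / (1 + s q). *)
Lemma borderline_Linf : Linf_norm (om^~ t) @[t --> +oo] --> nu%:E.
Proof.
apply: (@cvg_trans _ ((EFin \o (fun t => 2 * nu / (2 - k * decay t))) @ +oo)).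
  apply: near_eq_cvg; near=> t.
  have t0 : 0 <= t by near: t; exact: nbhs_pinfty_ge.
  rewrite /= Linf_norm_profile ?pb// am one_sub_pole2; congr EFin.
  have := two_sub_gt0 t0; have := expR_gt0 (- (nu * t)) => e0 h.
  by field; rewrite !gt_eqF.
rewrite (_ : nu%:E = (2 * nu / 2)%:E); last by congr EFin; field.
apply: cvg_EFin_comp; apply: cvgM; first exact: cvg_cst.
by apply: cvgV.
Unshelve. all: by end_near. Qed.

(** As soon as s q > 0 one has |q| = s q, and the norm equals 2 nu. *)
Lemma borderline_wiener : wiener_norm (om^~ t) @[t --> +oo] --> (2 * nu)%:E.
Proof.
apply: (@cvg_trans _ ((fun _ : R => (2 * nu)%:E) @ +oo)); last exact: cvg_cst.
apply: near_eq_cvg; near=> t.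
have t0 : 0 <= t by near: t; exact: nbhs_pinfty_ge.
have e1 : decay t < k^-1 by near: t; apply: (cvgr_lt 0 cvg_decay); rewrite invr_gt0.
rewrite wiener_norm_profile ?pb// am; congr EFin.
have e0 := expR_gt0 (- (nu * t)).
have ns : `|s| = 1 by apply/eqP; rewrite -(@eqrXn2 _ 2)// real_normK ?num_real// s2 expr1n.
have -> : `|pole t| = 1 - k * decay t.
  have -> : `|pole t| = `|s * pole t| by rewrite normrM ns mul1r.
  by rewrite sp ger0_norm// subr_ge0 -ler_pdivlMl// mulr1 ltW.
have -> : 1 - (1 - k * decay t) = k * decay t by ring.
by rewrite -[2 * nu * k * _]mulrA mulfK// mulf_neq0 ?gt_eqF.
Unshelve. all: by end_near. Qed.

(** The squared norm pi A^2 / (1 - q^2) is of order exp (- nu t). *)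
Lemma L2_borderline t : 0 <= t ->
  L2_norm (om^~ t) = (Num.sqrt (4 * pi * nu ^+ 2 * k / (2 - k * decay t)) * expR (- (nu * t) / 2))%:E.
Proof.
move=> t0; have e0 := expR_gt0 (- (nu * t)); have h := two_sub_gt0 t0.
rewrite L2_norm_profile ?pb//; congr EFin.
have ee : expR (- (nu * t) / 2) ^+ 2 = decay t.
  by rewrite -expRM_natr; congr expR; field.
have -> : pi * amplitude t ^+ 2 / (1 - pole t ^+ 2) =
    (4 * pi * nu ^+ 2 * k / (2 - k * decay t)) * expR (- (nu * t) / 2) ^+ 2.
  rewrite ee -(real_normK (num_real (amplitude t))) am one_sub_pole2.
  by generalize (pi : R) => P; field; rewrite !gt_eqF.
rewrite sqrtrM; last first.
  by rewrite divr_ge0 ?mulr_ge0 ?sqr_ge0 ?pi_ge0// ltW.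
by rewrite sqrtr_sqr ger0_norm// expR_ge0.
Qed.

Let cvg_L2_coef : Num.sqrt (4 * pi * nu ^+ 2 * k / (2 - k * decay t)) @[t --> +oo] -->
  Num.sqrt (4 * pi * nu ^+ 2 * k / 2).
Proof.
have cc : 4 * pi * nu ^+ 2 * k / (2 - k * decay t) @[t --> +oo] --> 4 * pi * nu ^+ 2 * k / 2.
  by apply: cvgM; [exact: cvg_cst|exact: cvgV].
by apply: (@cvg_comp _ _ _ _ Num.sqrt _ _ _ cc); exact: sqrt_continuous.
Qed.

Lemma cvg_decay_half : expR (- (nu * t) / 2) @[t --> +oo] --> (0 : R).
Proof.
have -> : (fun t => expR (- (nu * t) / 2)) = (fun t => expR (- (nu / 2 * t))).
  by apply/funext => t; congr expR; field.
apply: (@cvg_comp _ _ _ (fun t => nu / 2 * t) (fun x => expR (- x)) _ +oo); last exact: cvgr_expR.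
by apply: gt0_cvgMry; [rewrite divr_gt0|exact: cvg_id].
Qed.

Lemma borderline_L2 : L2_norm (om^~ t) @[t --> +oo] --> (0 : \bar R).
Proof.
apply: (@cvg_trans _ ((EFin \o (fun t => Num.sqrt (4 * pi * nu ^+ 2 * k / (2 - k * decay t))
    * expR (- (nu * t) / 2))) @ +oo)).
  apply: near_eq_cvg; near=> t.
  have t0 : 0 <= t by near: t; exact: nbhs_pinfty_ge.
  by rewrite L2_borderline.
have -> : (0 : \bar R) = (Num.sqrt (4 * pi * nu ^+ 2 * k / 2) * 0)%:E by rewrite mulr0.
by apply: cvg_EFin_comp; apply: cvgM; [exact: cvg_L2_coef|exact: cvg_decay_half].
Unshelve. all: by end_near. Qed.

Lemma borderline_L2_rate : behaves_like (fun t => fine (L2_norm (om^~ t)))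
  (fun t => expR (- (nu * t) / 2)).
Proof.
exists (Num.sqrt (4 * pi * nu ^+ 2 * k / 2)); split.
  by rewrite gt_eqF// sqrtr_gt0 divr_gt0// !mulr_gt0// ?pi_gt0// exprn_gt0.
apply: cvg_trans cvg_L2_coef; apply: near_eq_cvg; near=> t.
have t0 : 0 <= t by near: t; exact: nbhs_pinfty_ge.
by rewrite L2_borderline//= mulfK// gt_eqF// expR_gt0.
Unshelve. all: by end_near. Qed.

End borderline.
End Decay.

(** * The two borderline initial data *)

Section Limits.
Context {R : realType}.

Lemma cvg_of_ratio0 (F : set_system R) (f g : R -> R) (c : R) : Filter F ->
  (forall t, g t != 0) -> f t / g t @[t --> F] --> c -> g t @[t --> F] --> (0 : R) ->
    f t @[t --> F] --> (0 : R).
Proof.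
move=> FF g0 fg gc; have -> : f = (fun t => f t / g t * g t).
  by apply/funext => t; rewrite divfK.
by rewrite -(mulr0 c); apply: cvgM.
Qed.

Lemma cvgy_of_ratio (F : set_system R) (f g : R -> R) (c : R) : Filter F -> 0 < c ->
  (forall t, 0 < g t) -> f t / g t @[t --> F] --> c -> (g t)^-1 @[t --> F] --> (0 : R) ->
  f t @[t --> F] --> +oo.
Proof.
move=> FF c0 g0 fg gc.
apply/gtr0_cvgV0.
  near=> t; rewrite -[f t](divfK (lt0r_neq0 (g0 t))) mulr_gt0//; near: t.
  exact: (cvgr_gt c fg).
apply: (@cvg_trans _ ((fun t => (f t / g t)^-1 * (g t)^-1) @ F)).
  apply: near_eq_cvg; near=> t.
  by rewrite /= invfM invrK mulfK// gt_eqF.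
rewrite -(mulr0 c^-1); apply: cvgM => //.
by apply: cvgV => //; rewrite gt_eqF.
Unshelve. all: by end_near. Qed.
End Limits.

Section Borderline.
Context {R : realType}.
Variables (nu v0 w0 : R).
Hypotheses (nu_gt0 : 0 < nu) (v0_gt0 : 0 < v0).
Notation v := (vc nu v0 w0).
Notation w := (omega_m1 nu v0 w0).
Notation om := (omega nu v0 w0).
Notation pole := (pole nu v0 w0).
Notation amplitude := (amplitude nu v0 w0).
Notation decay t := (expR (- (nu * t))).
Let nz : nu != 0. Proof. by rewrite gt_eqF. Qed.
Let v1_gt0 : 0 < 1 + v0. Proof. by rewrite ltr_pwDl// ltW. Qed.
Let vz : 1 + v0 != 0. Proof. by rewrite gt_eqF. Qed.

Lemma omega_is_solution_bounded : - nu * v0 * (1 + v0) <= w0 <= nu * (1 + v0) ->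
  is_solution nu +oo%E om.
Proof.
move=> h; apply: omega_is_solution => // t t0 _; exact: pole_bounded_all.
Qed.

Lemma expR_decayV t : expR (nu * t) = (decay t)^-1.
Proof. by rewrite expRN invrK. Qed.

Section left_end.
Hypothesis w0E : w0 = - nu * v0 * (1 + v0).
Let k := 2 * v0 / (1 + v0).
Let k_gt0 : 0 < k. Proof. by rewrite divr_gt0// mulr_gt0. Qed.

Lemma left_end_range : - nu * v0 * (1 + v0) <= w0 <= nu * (1 + v0).
Proof.
rewrite w0E lexx /= (@le_trans _ _ 0)//; last by rewrite mulr_ge0 ?ltW.
by rewrite !mulNr oppr_le0 !mulr_ge0 ?ltW.
Qed.

Lemma left_end_pole t : pole t = 1 - k * decay t.
Proof. by rewrite /pole /vc_den w0E /k; field; rewrite nz vz. Qed.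

Lemma left_end_amplitude t : `|amplitude t| = 2 * nu * k * decay t.
Proof.
have -> : amplitude t = - (2 * nu * k * decay t).
  by rewrite /amplitude w0E /k; field; rewrite vz.
by rewrite normrN ger0_norm// mulr_ge0 ?expR_ge0// mulr_ge0 ?(ltW k_gt0)// mulr_ge0 ?ltW.
Qed.

Let cvg_two_sub : 2 - k * decay t @[t --> +oo] --> (2 : R).
Proof.
rewrite -[X in _ --> X]subr0 -[X in _ - X](mulr0 k).
by apply: cvgB; [exact: cvg_cst|apply: cvgM; [exact: cvg_cst|exact: cvg_decay]].
Qed.

Let one_add_pole t : 1 + pole t = 2 - k * decay t.
Proof. by rewrite left_end_pole; ring. Qed.

Let pole_neq0 t : 0 <= t -> 1 + pole t != 0.
Proof.
move=> t0; have := pole_bounded_all nu_gt0 v0_gt0 left_end_range t0.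
by rewrite ltr_norml => /andP[h1 h2]; rewrite gt_eqF//; lra.
Qed.

Lemma left_end_v : v t / decay t @[t --> +oo] --> k / 2.
Proof.
apply: (@cvg_trans _ ((fun t => k / (2 - k * decay t)) @ +oo)).
  apply: near_eq_cvg; near=> t.
  have t0 : 0 <= t by near: t; exact: nbhs_pinfty_ge.
  have := pole_neq0 t0; rewrite (vcE nu_gt0 v0_gt0 (pole_neq0 t0)) one_add_pole left_end_pole.
  move: (lt0r_neq0 (expR_gt0 (- (nu * t)))); generalize k => K e0 p0.
  by field; rewrite p0 e0.
by apply: cvgM; [exact: cvg_cst|exact: cvgV].
Unshelve. all: by end_near. Qed.

Lemma left_end_w : w t / decay t @[t --> +oo] --> 4 * w0 / (1 + v0) ^+ 2 / 2 ^+ 2.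
Proof.
apply: (@cvg_trans _ ((fun t => 4 * w0 / (1 + v0) ^+ 2 / (2 - k * decay t) ^+ 2) @ +oo)).
  apply: near_eq_cvg; near=> t.
  have t0 : 0 <= t by near: t; exact: nbhs_pinfty_ge.
  have := pole_neq0 t0; rewrite (omega_m1E nu_gt0 v0_gt0 (pole_neq0 t0)) one_add_pole /amplitude.
  move: (lt0r_neq0 (expR_gt0 (- (nu * t)))); generalize k => K e0 p0.
  by field; rewrite p0 vz e0.
apply: cvgM; first exact: cvg_cst.
by apply: cvgV; [rewrite expf_neq0|apply: cvgM].
Unshelve. all: by end_near. Qed.
End left_end.

Section right_end.
Hypothesis w0E : w0 = nu * (1 + v0).
Let k := 2 / (1 + v0).
Let k_gt0 : 0 < k. Proof. by rewrite divr_gt0. Qed.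

Lemma right_end_range : - nu * v0 * (1 + v0) <= w0 <= nu * (1 + v0).
Proof.
rewrite w0E lexx andbT (@le_trans _ _ 0)//; last by rewrite mulr_ge0 ?ltW.
by rewrite !mulNr oppr_le0 !mulr_ge0 ?ltW.
Qed.

Lemma right_end_pole t : - 1 * pole t = 1 - k * decay t.
Proof. by rewrite /pole /vc_den w0E /k; field; rewrite nz vz. Qed.

Lemma right_end_amplitude t : `|amplitude t| = 2 * nu * k * decay t.
Proof.
have -> : amplitude t = 2 * nu * k * decay t.
  by rewrite /amplitude w0E /k; field; rewrite vz.
by rewrite ger0_norm// mulr_ge0 ?expR_ge0// mulr_ge0 ?(ltW k_gt0)// mulr_ge0 ?ltW.
Qed.

Let one_add_pole t : 1 + pole t = k * decay t.
Proof. by have := right_end_pole t; lra. Qed.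

Let pole_neq0 t : 1 + pole t != 0.
Proof. by rewrite one_add_pole gt_eqF// mulr_gt0 ?expR_gt0. Qed.

Lemma right_end_v : v t / expR (nu * t) @[t --> +oo] --> (1 + v0).
Proof.
have -> : (fun t => v t / expR (nu * t)) = (fun t => (1 + v0) - decay t).
  apply/funext => t; rewrite vcE// one_add_pole expR_decayV.
  have -> : 1 - pole t = 2 - k * decay t by have := one_add_pole t; lra.
  by rewrite /k; field; rewrite vz gt_eqF// expR_gt0.
rewrite -[X in _ --> X]subr0.
by apply: cvgB; [exact: cvg_cst|exact: cvg_decay].
Qed.

Lemma right_end_w : w t / expR (nu * t) @[t --> +oo] --> w0.
Proof.
have -> : (fun t => w t / expR (nu * t)) = (fun t => w0).
  apply/funext => t; rewrite omega_m1E// one_add_pole expR_decayV /amplitude /k.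
  by field; rewrite vz gt_eqF// expR_gt0.
exact: cvg_cst.
Qed.
End right_end.
End Borderline.

(** * Blow-up at a finite time *)

Section Extension.
Context {R : realType}.

(** A continuous continuation is bounded near (x, tc), which contradicts the
    unboundedness of u near x as t tends to tc. *)
Lemma blowup_no_extension (nu tc x : R) (T : \bar R) (u u' : R -> R -> R) :
  0 < tc -> blowup_points u tc x -> (tc%:E < T)%E ->
  (forall y t, 0 <= t -> t < tc -> u' y t = u y t) -> ~ is_solution nu T u'.
Proof.
move=> tc0 [_ bx] tcT uu' [cu _ _ _ _].
pose S := [set z : R * R | 0 <= z.2 /\ (z.2%:E < T)%E].
have Sx : S (x, tc) by split => //=; exact: ltW.
have /subspace_continuousP /(_ _ Sx) := cu.
move=> /(@cvgrPdist_lt) /(_ 1 ltr01) /nbhs_ballP[d /= d0 bd].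
have [y [t [cy yx t0 /andP[t1 t2] ut]]] := bx d (`|u' x tc| + 1) d0.
have tT : (t%:E < T)%E by apply: lt_trans tcT; rewrite lte_fin.
have bt : ball (x, tc) d (y, t).
  by split; rewrite /= /ball/=; [rewrite distrC|rewrite gtr0_norm; lra].
have := bd (y, t) bt (conj t0 tT); rewrite /from_subspace /= (uu' y t t0 t2) => h.
have : `|u y t| <= `|u' x tc| + `|u' x tc - u y t|.
  have E : u y t = u' x tc - (u' x tc - u y t) by ring.
  by rewrite {1}E; exact: ler_normB.
lra.
Qed.
End Extension.

Section BlowUp.
Context {R : realType}.
Variables (nu v0 w0 : R).
Hypotheses (nu_gt0 : 0 < nu) (v0_gt0 : 0 < v0) (w0_neq0 : w0 != 0).
Notation om := (omega nu v0 w0).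
Notation pole := (pole nu v0 w0).
Notation amplitude := (amplitude nu v0 w0).
Notation decay t := (expR (- (nu * t))).
Let v1_gt0 : 0 < 1 + v0. Proof. by rewrite ltr_pwDl// ltW. Qed.
Let vz : 1 + v0 != 0. Proof. by rewrite gt_eqF. Qed.

Lemma amplitude_neq0 t : amplitude t != 0.
Proof. by rewrite /amplitude !mulf_neq0// ?invr_eq0 ?expf_neq0// gt_eqF// expR_gt0. Qed.

Lemma amplitude_le t : 0 <= t -> `|amplitude t| <= 4 * `|w0| / (1 + v0) ^+ 2.
Proof.
move=> t0; rewrite /amplitude mulrAC normrM [`|decay t|]ger0_norm ?expR_ge0//.
rewrite !normrM normfV [`|_ ^+ 2|]ger0_norm ?sqr_ge0// [`|4|]ger0_norm//.
rewrite ler_piMr ?decay_le1//.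
by apply: divr_ge0; [rewrite mulr_ge0|exact: sqr_ge0].
Qed.

(** From poisson_den = (1 - s q)^2 + 2 s q (1 - s cos y): once s q >= 1/2 the
    denominator is at least 1 - s cos y, uniformly in q. *)
Lemma sin_kernel_away (q s y : R) : `|q| < 1 -> s ^+ 2 = 1 -> 2^-1 <= s * q ->
  `|sin_kernel q y| * (1 - s * cos y) <= 1.
Proof.
move=> q1 s2 sq; have k0 := poisson_den_gt0 y q1.
have kE : poisson_den q y = (1 - s * q) ^+ 2 + 2 * (s * q) * (1 - s * cos y).
  have -> : (1 - s * q) ^+ 2 + 2 * (s * q) * (1 - s * cos y) =
     1 + s ^+ 2 * q ^+ 2 - 2 * s ^+ 2 * q * cos y by ring.
  by rewrite s2 /poisson_den; ring.
have ns : `|s| = 1 by apply/eqP; rewrite -(@eqrXn2 _ 2)// real_normK ?num_real// s2 expr1n.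
have sc : 0 <= 1 - s * cos y.
  by rewrite subr_ge0 (le_trans (ler_norm _))// normrM ns mul1r cos_max.
have kge : 1 - s * cos y <= poisson_den q y.
  rewrite kE; have := sqr_ge0 (1 - s * q).
  have : 1 * (1 - s * cos y) <= 2 * (s * q) * (1 - s * cos y) by apply: ler_wpM2r => //; lra.
  lra.
rewrite /sin_kernel normrM normfV [`|poisson_den _ _|]gtr0_norm// mulrAC ler_pdivrMr// mul1r.
by rewrite (le_trans _ kge)// ler_piMl// sin_max.
Qed.

Section blowup_time.
Variables (s tc : R).
Hypotheses (s2 : s ^+ 2 = 1) (tc_gt0 : 0 < tc)
  (pb : forall t, 0 <= t -> t < tc -> `|pole t| < 1) (ptc : pole tc = s).

Let near_tc : \forall t \near tc^'-, 0 <= t /\ t < tc.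
Proof.
near=> t; split; last by near: t; exact: nbhs_left_lt.
by apply/ltW; near: t; exact: nbhs_left_gt.
Unshelve. all: by end_near. Qed.

Let cvg_pole : pole t @[t --> tc^'-] --> s.
Proof. by rewrite -ptc; apply: cvg_at_left_filter; exact: continuous_pole. Qed.

Let cvg_amplitude : amplitude t @[t --> tc^'-] --> amplitude tc.
Proof. by apply: cvg_at_left_filter; exact: continuous_amplitude. Qed.

Let cvg_gap : 1 - pole t ^+ 2 @[t --> tc^'-] --> (0 : R).
Proof.
rewrite (_ : 0 = 1 - s ^+ 2); last by rewrite s2 subrr.
by apply: cvgB; [exact: cvg_cst|apply: cvgM; exact: cvg_pole].
Qed.

Let gap_gt0 t : 0 <= t /\ t < tc -> 0 < 1 - pole t ^+ 2.
Proof. by case=> t0 t1; apply: one_sub_sqr_gt0; exact: pb. Qed.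

Let peak t := `|amplitude t| / (1 - pole t ^+ 2).

Let cvg_peak : peak t @[t --> tc^'-] --> +oo.
Proof.
apply/gtr0_cvgV0.
  near=> t; rewrite divr_gt0 ?normr_gt0 ?amplitude_neq0// gap_gt0//.
  by near: t; exact: near_tc.
apply: (@cvg_trans _ ((fun t => (1 - pole t ^+ 2) * `|amplitude t|^-1) @ tc^'-)).
  by apply: near_eq_cvg; near=> t; rewrite /= /peak invf_div.
rewrite -(mul0r `|amplitude tc|^-1); apply: cvgM; first exact: cvg_gap.
apply: cvgV; first by rewrite normr_eq0 amplitude_neq0.
exact: cvg_norm cvg_amplitude.
Unshelve. all: by end_near. Qed.

Lemma blowup_Linf : Linf_norm (om^~ t) @[t --> tc^'-] --> +oo%E.
Proof.
apply: (@cvg_trans _ ((fun t => (peak t)%:E) @ tc^'-)); last exact/cvgeryP.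
apply: near_eq_cvg; near=> t.
have [t0 t1] : 0 <= t /\ t < tc by near: t; exact: near_tc.
by rewrite Linf_norm_profile ?pb.
Unshelve. all: by end_near. Qed.

(** The squared norm is pi |A| times the maximum |A| / (1 - q^2). *)
Lemma blowup_L2 : L2_norm (om^~ t) @[t --> tc^'-] --> +oo%E.
Proof.
pose h t := Num.sqrt (pi * amplitude t ^+ 2 / (1 - pole t ^+ 2)).
have hy : h t @[t --> tc^'-] --> +oo.
  apply/gtr0_cvgV0.
    near=> t; rewrite sqrtr_gt0; apply: divr_gt0.
      by apply: mulr_gt0; [exact: pi_gt0|rewrite lt0r expf_neq0 ?amplitude_neq0// sqr_ge0].
    by apply: gap_gt0; near: t; exact: near_tc.
  apply: (@cvg_trans _ ((fun t => Num.sqrt ((1 - pole t ^+ 2) * (pi * amplitude t ^+ 2)^-1)) @ tc^'-)).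
    apply: near_eq_cvg; near=> t; rewrite /= /h -sqrtrV ?invf_div//.
    apply: divr_ge0; first by apply: mulr_ge0; [exact: pi_ge0|exact: sqr_ge0].
    by apply/ltW/gap_gt0; near: t; exact: near_tc.
  rewrite -(@sqrtr0 R).
  have cc : (1 - pole t ^+ 2) * (pi * amplitude t ^+ 2)^-1 @[t --> tc^'-] --> (0 : R).
    rewrite -(mul0r (pi * amplitude tc ^+ 2)^-1); apply: cvgM; first exact: cvg_gap.
    apply: cvgV; first by rewrite mulf_neq0 ?expf_neq0 ?amplitude_neq0// gt_eqF// pi_gt0.
    by apply: cvgM; [exact: cvg_cst|apply: cvgM; exact: cvg_amplitude].
  by apply: (@cvg_comp _ _ _ _ Num.sqrt _ _ _ cc); exact: sqrt_continuous.
apply: (@cvg_trans _ ((fun t => (h t)%:E) @ tc^'-)); last exact/cvgeryP.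
apply: near_eq_cvg; near=> t.
have [t0 t1] : 0 <= t /\ t < tc by near: t; exact: near_tc.
by rewrite L2_norm_profile ?pb.
Unshelve. all: by end_near. Qed.

Let Amax := 4 * `|w0| / (1 + v0) ^+ 2.

Lemma omega_away y t : 0 <= t -> t < tc -> 2^-1 <= s * pole t ->
  `|om y t| * (1 - s * cos y) <= Amax.
Proof.
move=> t0 t1 sp; rewrite omegaE ?pb// normrM -mulrA.
rewrite (le_trans _ (amplitude_le t0))// ler_piMr//.
by apply: sin_kernel_away => //; exact: pb.
Qed.

Lemma half_le_pole : \forall t \near tc, 2^-1 <= s * pole t.
Proof.
have : s * pole t @[t --> tc] --> s * pole tc.
  by apply: cvgM; [exact: cvg_cst|exact: continuous_pole].
rewrite ptc -expr2 s2 => c.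
by near=> t; apply/ltW; near: t; apply: (cvgr_gt 1 c); rewrite invf_lt1// ltr1n.
Unshelve. all: by end_near. Qed.

(** The maximum |A| / (1 - q^2) is attained somewhere, and [omega_away] forces
    the point where it is attained towards the set where cos y = s. *)
Lemma blowup_peak (d M eta : R) : 0 < d -> 0 < eta -> exists y t,
  [/\ - pi < y < pi, 0 <= t, tc - d < t < tc, M < `|om y t| & 1 - s * cos y < eta].
Proof.
move=> d0 eta0.
have : \forall t \near tc^'-, [/\ 0 <= t, tc - d < t < tc, 2^-1 <= s * pole t,
    M < peak t & Amax / eta < peak t].
  near=> t.
  have [t0 t1] : 0 <= t /\ t < tc by near: t; exact: near_tc.
  split => //.
  - by rewrite t1 andbT; near: t; apply: nbhs_left_gt; rewrite ltrBlDr ltrDl.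
  - by near: t; apply: cvg_at_left_filter half_le_pole; exact: cvg_id.
  - by near: t; exact: (cvgry_gt cvg_peak).
  (* a peak this high cannot be attained where eta <= 1 - s cos y *)
  - by near: t; exact: (cvgry_gt cvg_peak).
move=> /filter_ex[t [t0 t1 sp Mp Ap]].
have q1 : `|pole t| < 1 by apply: pb => //; case/andP : t1.
have [y yb yE] := sin_kernel_max q1.
have oE : `|om y t| = peak t.
  by rewrite omegaE// yE normrM [`|_^-1|]ger0_norm// invr_ge0 ltW// one_sub_sqr_gt0.
exists y, t; split => //; first by rewrite oE.
rewrite ltNge; apply/negP => etay.
have t2 : t < tc by case/andP : t1.
have := omega_away y t0 t2 sp; rewrite oE; apply/negP; rewrite -ltNge.
apply: (@lt_le_trans _ _ (peak t * eta)); first by rewrite -ltr_pdivrMr.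
by rewrite ler_wpM2l// -oE.
Unshelve. all: by end_near. Qed.

(** Near x the quantity 1 - s cos y is bounded below, so [omega_away] bounds
    the solution there. *)
Lemma not_blowup x : s * cos x < 1 -> ~ blowup_points om tc x.
Proof.
move=> sx [_ bx]; pose eta := (1 - s * cos x) / 2.
have eta0 : 0 < eta by rewrite divr_gt0// subr_gt0.
have : \forall y \near x, eta < 1 - s * cos y.
  have c : 1 - s * cos y @[y --> x] --> 1 - s * cos x.
    apply: cvgB; first exact: cvg_cst.
    by apply: cvgM; [exact: cvg_cst|exact: continuous_cos].
  by apply: (cvgr_gt _ c); rewrite /eta; lra.
move=> /nbhs_ballP[d1 /= d10 H1].
have /nbhs_ballP[d2 /= d20 H2] := half_le_pole.
have [] := bx (Num.min d1 d2) (Amax / eta); first by rewrite lt_min d10.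
move=> y [t [cy yx t0 /andP[t1 t2] My]].
move: yx; rewrite lt_min => /andP[y1 _].
have td : tc - d2 < t by apply: le_lt_trans t1; rewrite lerB// ge_min lexx orbT.
have e1 : eta < 1 - s * cos y by apply: H1; rewrite /ball/= distrC.
have e2 : 2^-1 <= s * pole t by apply: H2; rewrite /ball/= gtr0_norm; lra.
have := omega_away y t0 t2 e2; apply/negP; rewrite -ltNge.
move: My; rewrite ltr_pdivrMr// => My; rewrite (lt_le_trans My)//.
by rewrite ler_wpM2l// ltW.
Qed.

Lemma omega_solution_until x : blowup_points om tc x -> solution_until nu tc om.
Proof.
move=> bx; split => //.
  by apply: omega_is_solution => // t t0; rewrite lte_fin; exact: pb.
by move=> T u' tT uu'; apply: blowup_no_extension bx tT uu'.
Qed.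

End blowup_time.
End BlowUp.

(** * Location and time of the blow-up *)

Section Location.
Context {R : realType}.
Implicit Types d x y : R.

Lemma norm_le_pi y : - pi <= y <= pi -> `|y| \in `[0, pi].
Proof. by move=> h; rewrite in_itv/= normr_ge0 ler_norml. Qed.

Lemma cos_near_1 d : 0 < d -> exists2 eta : R, 0 < eta &
  forall y, - pi <= y <= pi -> 1 - 1 * cos y < eta -> `|y| < d.
Proof.
(* cos is strictly decreasing on [0, pi] only. *)
move=> d0; pose d' := Num.min d pi.
have d'0 : 0 < d' by rewrite lt_min d0 pi_gt0.
have d'I : d' \in `[0, pi] by rewrite in_itv/= ltW//= ge_min lexx orbT.
have zI : (0 : R) \in `[0, pi] by rewrite in_itv/= lexx pi_ge0.
exists (1 - cos d'); first by rewrite subr_gt0 -(@cos0 R) ltr_cos.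
move=> y yI; rewrite mul1r -cos_norm ltrD2l ltrN2 ltr_cos ?norm_le_pi// => yd.
by rewrite (lt_le_trans yd)// ge_min lexx.
Qed.

Lemma cos_near_N1 d : 0 < d -> exists2 eta : R, 0 < eta &
  forall y, - pi <= y <= pi -> 1 - -1 * cos y < eta -> pi - `|y| < d.
Proof.
move=> d0; have [eta eta0 H] := cos_near_1 d0; exists eta => // y yI.
rewrite mulN1r -cos_norm => h.
have nI := norm_le_pi yI.
have pI : - pi <= pi - `|y| <= pi.
  by move: nI; rewrite in_itv/= => /andP[? ?]; apply/andP; split; lra.
apply: le_lt_trans (H _ pI _); first exact: ler_norm.
by rewrite mul1r cosB cospi sinpi mul0r addr0 mulN1r.
Qed.

Lemma cos_eq1 x : - pi <= x <= pi -> cos x = 1 -> x = 0.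
Proof.
move=> xI cx; apply/normr0_eq0; apply: cos_inj; rewrite ?norm_le_pi//.
  by rewrite in_itv/= lexx pi_ge0.
by rewrite cos_norm cx cos0.
Qed.

Lemma cos_eqN1 x : - pi <= x <= pi -> cos x = -1 -> `|x| = pi.
Proof.
move=> xI cx; apply: cos_inj; rewrite ?norm_le_pi//.
  by rewrite in_itv/= lexx pi_ge0.
by rewrite cos_norm cx cospi.
Qed.
End Location.

Section Cases.
Context {R : realType}.
Variables (nu v0 w0 : R).
Hypotheses (nu_gt0 : 0 < nu) (v0_gt0 : 0 < v0) (w0_neq0 : w0 != 0).
Notation v := (vc nu v0 w0).
Notation om := (omega nu v0 w0).
Notation pole := (pole nu v0 w0).
Notation decay t := (expR (- (nu * t))).
Let nz : nu != 0. Proof. by rewrite gt_eqF. Qed.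
Let v1_gt0 : 0 < 1 + v0. Proof. by rewrite ltr_pwDl// ltW. Qed.
Let vz : 1 + v0 != 0. Proof. by rewrite gt_eqF. Qed.

Section points.
Variable tc : R.
Hypotheses (tc_gt0 : 0 < tc) (pb : forall t, 0 <= t -> t < tc -> `|pole t| < 1).

Lemma blowup_points_0 : pole tc = 1 -> blowup_points om tc = [set 0].
Proof.
move=> ptc; have s2 : (1 : R) ^+ 2 = 1 by rewrite expr1n.
apply/seteqP; split => [x bx|x -> /=].
  have /circleP xI := bx.1.
  apply: cos_eq1 => //; apply/eqP; rewrite eq_le cos_le1 leNgt; apply/negP => c1.
  by apply: (not_blowup nu_gt0 v0_gt0 s2 pb ptc _ bx); rewrite mul1r.
split; first by apply/circleP; rewrite oppr_le0 pi_ge0.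
move=> d M d0; have [eta eta0 H] := cos_near_1 d0.
have [y [t [/andP[y1 y2] t0 td My ye]]] :=
  blowup_peak nu_gt0 v0_gt0 w0_neq0 s2 tc_gt0 pb ptc M d0 eta0.
have yI : - pi <= y <= pi by rewrite !ltW.
by exists y, t; split => //; rewrite subr0 H.
Qed.

(** The solution is odd in y, so the points of large value come in pairs y and
    - y and approach both ends of the interval. *)
Lemma blowup_points_pi : pole tc = -1 -> blowup_points om tc = [set - pi; pi].
Proof.
move=> ptc; have s2 : (-1 : R) ^+ 2 = 1 by rewrite sqrrN expr1n.
apply/seteqP; split => [x bx|x].
  have /circleP xI := bx.1.
  have /eqP : `|x| = pi.
    apply: cos_eqN1 => //; apply/eqP; rewrite eq_le cos_geN1 andbT leNgt; apply/negP => c1.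
    by apply: (not_blowup nu_gt0 v0_gt0 s2 pb ptc _ bx); rewrite mulN1r ltrNl.
  by rewrite eqr_norml pi_ge0 andbT => /orP[] /eqP ->; [right|left].
move=> xE; have p0 := @pi_gt0 R; split.
  by apply/circleP; case: xE => ->; rewrite lexx ?andbT; lra.
move=> d M d0; have [eta eta0 H] := cos_near_N1 d0.
have [y [t [/andP[y1 y2] t0 td My ye]]] :=
  blowup_peak nu_gt0 v0_gt0 w0_neq0 s2 tc_gt0 pb ptc M d0 eta0.
have yI : - pi <= y <= pi by rewrite !ltW.
have q1 : `|pole t| < 1 by apply: pb => //; case/andP : td.
have oN : `|om (- y) t| = `|om y t|.
  by rewrite !omegaE// /sin_kernel sinN /poisson_den cosN mulNr mulrN normrN.
have := H y yI ye => yd.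
have n1 : - pi <= `|y| <= pi.
  by have := norm_le_pi yI; rewrite in_itv/= => /andP[? ?]; apply/andP; split; lra.
have n2 : - pi <= - `|y| <= pi by move/andP : n1 => [? ?]; apply/andP; split; lra.
have nE : `|om `|y| t| = `|om y t| by case: (ger0P y) => // _; rewrite oN.
have nE' : `|om (- `|y|) t| = `|om y t|.
  by case: (ger0P y) => // _; rewrite opprK.
case: xE => ->.
  exists (- `|y|), t; split => //; last by rewrite nE'.
  by rewrite opprK addrC ger0_norm// subr_ge0; case/andP : n1.
exists `|y|, t; split => //; last by rewrite nE.
by rewrite distrC ger0_norm// subr_ge0; case/andP : n1.
Qed.
End points.

Lemma decay_log r : 0 < r -> decay (nu^-1 * ln r) = r^-1.
Proof. by move=> r0; rewrite mulVKf// expRN lnK. Qed.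

Section collapse.
Hypothesis w0_lt : w0 < - nu * v0 * (1 + v0).
Let K := nu * v0 * (1 + v0).
Let tc := nu^-1 * ln (w0 / (w0 + nu * v0 * (1 + v0))).

Let K_gt0 : 0 < K. Proof. by rewrite !mulr_gt0. Qed.
Let wK : w0 + K < 0.
Proof. by move: w0_lt; rewrite !mulNr -/K; set L := K => h; lra. Qed.
Let w_lt0 : w0 < 0.
Proof. by have := wK; have := K_gt0; set L := K => h1 h2; lra. Qed.
Let ratio_gt1 : 1 < w0 / (w0 + K).
Proof. by rewrite ltr_ndivlMr// mul1r ltrDl. Qed.

Lemma collapse_tc_gt0 : 0 < tc.
Proof. by rewrite mulr_gt0 ?invr_gt0// ln_gt0. Qed.

Lemma collapse_decay : decay tc = (w0 + K) / w0.
Proof. by rewrite decay_log ?invf_div// (lt_trans ltr01). Qed.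

Lemma collapse_num : vc_num nu v0 w0 tc = 0.
Proof.
by rewrite /vc_num collapse_decay /K; field; rewrite w0_neq0.
Qed.

(** The value q = 1 corresponds to v_c = 0. *)
Lemma collapse_pole : pole tc = 1.
Proof.
have := collapse_num; rewrite (vc_numE _ nu_gt0 v0_gt0) => /eqP.
rewrite mulf_eq0 invr_eq0 pnatr_eq0 orbF mulf_eq0 gt_eqF/=; last by rewrite mulr_gt0// exprn_gt0.
by rewrite subr_eq0 => /eqP.
Qed.

(** The numerator of v_c decreases to 0, its value at tc, while the denominator
    stays positive. *)
Lemma collapse_bounded t : 0 <= t -> t < tc -> `|pole t| < 1.
Proof.
move=> t0 t1; have e1 := decay_lt nu_gt0 t1; have e2 := decay_le1 nu_gt0 t0.
apply: pole_bounded => //; rewrite /vc_num /vc_den.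
  have := collapse_num; rewrite /vc_num -/K => n0.
  rewrite -subr_gt0 subr0 -n0 -subr_gt0.
  have -> : w0 * (1 - decay t) + K - (w0 * (1 - decay tc) + K)
    = (- w0) * (decay t - decay tc) by ring.
  by rewrite mulr_gt0 ?subr_gt0// oppr_gt0.
apply: ltr_wpDl; last exact: mulr_gt0.
by rewrite mulr_ge0 ?subr_ge0// oppr_ge0 ltW.
Qed.
End collapse.

Section escape.
Hypothesis w0_gt : nu * (1 + v0) < w0.
Let K := nu * (1 + v0).
Let tc := nu^-1 * ln (w0 / (w0 - nu * (1 + v0))).

Let K_gt0 : 0 < K. Proof. by rewrite !mulr_gt0. Qed.
Let wK : 0 < w0 - K. Proof. by rewrite subr_gt0. Qed.
Let w_gt0 : 0 < w0. Proof. exact: lt_trans K_gt0 w0_gt. Qed.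
Let ratio_gt1 : 1 < w0 / (w0 - K).
Proof. by rewrite ltr_pdivlMr// mul1r gtrBl. Qed.

Lemma escape_tc_gt0 : 0 < tc.
Proof. by rewrite mulr_gt0 ?invr_gt0// ln_gt0. Qed.

Lemma escape_decay : decay tc = (w0 - K) / w0.
Proof. by rewrite decay_log ?invf_div// (lt_trans ltr01). Qed.

Lemma escape_den : vc_den nu v0 w0 tc = 0.
Proof.
by rewrite /vc_den escape_decay /K; field; rewrite w0_neq0.
Qed.

(** The value q = -1 corresponds to v_c = oo. *)
Lemma escape_pole : pole tc = -1.
Proof.
have := escape_den; rewrite (vc_denE _ nu_gt0 v0_gt0) => /eqP.
rewrite mulf_eq0 invr_eq0 pnatr_eq0 orbF mulf_eq0 gt_eqF/=; last by rewrite mulr_gt0// exprn_gt0.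
by rewrite addrC addr_eq0 => /eqP.
Qed.

(** The denominator of v_c decreases to 0, its value at tc, while the numerator
    stays positive. *)
Lemma escape_bounded t : 0 <= t -> t < tc -> `|pole t| < 1.
Proof.
move=> t0 t1; have e1 := decay_lt nu_gt0 t1; have e2 := decay_le1 nu_gt0 t0.
apply: pole_bounded => //; rewrite /vc_num /vc_den.
  apply: ltr_wpDl; last by rewrite !mulr_gt0.
  by rewrite mulr_ge0 ?subr_ge0// ltW.
have := escape_den; rewrite /vc_den -/K => n0.
rewrite -subr_gt0 subr0 -n0 -subr_gt0.
have -> : - w0 * (1 - decay t) + K - (- w0 * (1 - decay tc) + K)
  = w0 * (decay t - decay tc) by ring.
by rewrite mulr_gt0 ?subr_gt0.
Qed.

Lemma escape_vc_cvg : v t @[t --> tc^'-] --> +oo.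
Proof.
have near_tc : \forall t \near tc^'-, `|pole t| < 1.
  near=> t; apply: escape_bounded; last by near: t; exact: nbhs_left_lt.
  by apply/ltW; near: t; apply: nbhs_left_gt; exact: escape_tc_gt0.
have cp : pole t @[t --> tc^'-] --> (-1 : R).
  by rewrite -escape_pole; apply: cvg_at_left_filter; exact: continuous_pole.
have vE : \forall t \near tc^'-, v t = (1 - pole t) / (1 + pole t) /\ 0 < v t.
  near=> t; have : `|pole t| < 1 by near: t.
  rewrite ltr_norml => /andP[h1 h2].
  have p0 : 0 < 1 + pole t by lra.
  by rewrite vcE ?gt_eqF// divr_gt0//; lra.
apply/gtr0_cvgV0; first by apply: filterS vE => t [].
apply: (@cvg_trans _ ((fun t => (1 + pole t) / (1 - pole t)) @ tc^'-)).
  by apply: near_eq_cvg; near=> t; have [//|/= -> _] := near vE t; rewrite invf_div.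
rewrite (_ : 0 = (1 + -1) / (1 - -1) :> R); last by rewrite subrr mul0r.
apply: cvgM; first by apply: cvgD; [exact: cvg_cst|exact: cp].
apply: cvgV; first by rewrite opprK.
by apply: cvgB; [exact: cvg_cst|exact: cp].
Unshelve. all: by end_near. Qed.
End escape.
End Cases.

(** * The initial norms and the theorem *)

Section Assembly.
Context {R : realType}.
Implicit Types nu e : R.

Lemma L2_norm_initial nu (v0 w0 : R) : 0 < nu -> 0 < v0 ->
  L2_norm ((omega nu v0 w0)^~ 0%R) =
    (2 * Num.sqrt pi * `|w0| / (Num.sqrt v0 * (1 + v0)))%:E.
Proof.
move=> nu0 v00; rewrite L2_norm_omega ?pole_bounded_at0//.
by rewrite vc_at0// omega_m1_at0.
Qed.

Lemma Linf_norm_initial nu (v0 w0 : R) : 0 < nu -> 0 < v0 ->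
  Linf_norm ((omega nu v0 w0)^~ 0%R) = (`|w0| / v0)%:E.
Proof.
move=> nu0 v00; rewrite Linf_norm_omega ?pole_bounded_at0//.
by rewrite vc_at0// omega_m1_at0.
Qed.

Lemma wiener_norm_initial nu (v0 w0 : R) : 0 < nu -> 0 < v0 ->
  wiener_norm ((omega nu v0 w0)^~ 0%R) =
    (`|w0| / v0 * (`|1 - v0| / (1 + v0) + 1))%:E.
Proof.
move=> nu0 v00; rewrite wiener_norm_omega ?pole_bounded_at0//.
by rewrite vc_at0// omega_m1_at0.
Qed.

Lemma L2_norm_initial_gt nu (v0 w0 : R) : 0 < nu -> 0 < v0 ->
  nu * v0 * (1 + v0) < `|w0| ->
  ((2 * nu * Num.sqrt (pi * v0))%:E < L2_norm ((omega nu v0 w0)^~ 0%R))%E.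
Proof.
move=> nu0 v00 h; rewrite L2_norm_initial// lte_fin.
have v1 : 0 < 1 + v0 by lra.
have sv : 0 < Num.sqrt v0 by rewrite sqrtr_gt0.
have sp : 0 < Num.sqrt (pi : R) by rewrite sqrtr_gt0 pi_gt0.
rewrite sqrtrM ?pi_ge0// ltr_pdivlMr ?mulr_gt0//.
have -> : 2 * nu * (Num.sqrt pi * Num.sqrt v0) * (Num.sqrt v0 * (1 + v0)) =
    2 * Num.sqrt pi * (nu * Num.sqrt v0 ^+ 2 * (1 + v0)) by ring.
by rewrite sqr_sqrtr ?ltW// ltr_pM2l// mulr_gt0.
Qed.

Lemma L2_norm_initial_gt_inv nu (v0 w0 : R) : 0 < nu -> 0 < v0 ->
  nu * (1 + v0) < `|w0| ->
  ((2 * nu * Num.sqrt (pi / v0))%:E < L2_norm ((omega nu v0 w0)^~ 0%R))%E.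
Proof.
move=> nu0 v00 h; rewrite L2_norm_initial// lte_fin.
have v1 : 0 < 1 + v0 by lra.
have sv : 0 < Num.sqrt v0 by rewrite sqrtr_gt0.
have sp : 0 < Num.sqrt (pi : R) by rewrite sqrtr_gt0 pi_gt0.
rewrite sqrtrM ?pi_ge0// sqrtrV ?ltW// ltr_pdivlMr ?mulr_gt0//.
have -> : 2 * nu * (Num.sqrt pi * (Num.sqrt v0)^-1) * (Num.sqrt v0 * (1 + v0)) =
    2 * Num.sqrt pi * (nu * (1 + v0)) by field; rewrite gt_eqF.
by rewrite ltr_pM2l// mulr_gt0.
Qed.

Lemma wiener_norm_initial_lt1 nu (v0 w0 : R) : 0 < nu -> 0 < v0 -> v0 < 1 ->
  wiener_norm ((omega nu v0 w0)^~ 0%R) = (2 * `|w0| / (v0 * (1 + v0)))%:E.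
Proof.
move=> nu0 v00 v1; rewrite wiener_norm_initial//; congr EFin.
rewrite [`|1 - v0|]gtr0_norm ?subr_gt0//; field.
by rewrite !gt_eqF//; lra.
Qed.

Lemma wiener_norm_initial_ge1 nu (v0 w0 : R) : 0 < nu -> 0 < v0 -> 1 <= v0 ->
  wiener_norm ((omega nu v0 w0)^~ 0%R) = (2 * `|w0| / (1 + v0))%:E.
Proof.
move=> nu0 v00 v1; rewrite wiener_norm_initial//; congr EFin.
rewrite [`|1 - v0|]ler0_norm ?subr_le0//; field.
by rewrite !gt_eqF//; lra.
Qed.

(** Taking w0 equal to twice the threshold makes the norm a multiple of
    sqrt v0. *)
Lemma L2_norm_initial_small_collapse nu e : 0 < nu -> 0 < e -> exists d : R, 0 < d /\
    forall v0' : R, 0 < v0' -> v0' < d -> exists w0' : R,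
      w0' < - nu * v0' * (1 + v0') /\
      (L2_norm ((omega nu v0' w0')^~ 0%R) < e%:E)%E.
Proof.
move=> nu0 e0; have sp : 0 < Num.sqrt (pi : R) by rewrite sqrtr_gt0 pi_gt0.
pose c := 4 * Num.sqrt pi * nu; have c0 : 0 < c by rewrite !mulr_gt0.
exists ((e / c) ^+ 2); split; first by rewrite exprn_gt0// divr_gt0.
move=> v v_gt0 vd; exists (2 * (- nu * v * (1 + v))).
have v1 : 0 < 1 + v by lra.
have k0 : 0 < nu * v * (1 + v) by rewrite !mulr_gt0.
split; first by rewrite !mulNr mulrN; lra.
have sv : 0 < Num.sqrt v by rewrite sqrtr_gt0.
rewrite L2_norm_initial// lte_fin.
have -> : `|2 * (- nu * v * (1 + v))| = 2 * (nu * v * (1 + v)).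
  by rewrite !mulNr mulrN normrN gtr0_norm// mulr_gt0.
have -> : 2 * Num.sqrt pi * (2 * (nu * v * (1 + v))) / (Num.sqrt v * (1 + v)) = c * Num.sqrt v.
  have vE : v = Num.sqrt v ^+ 2 by rewrite sqr_sqrtr// ltW.
  move: v1 sv; rewrite [X in 1 + X]vE [X in nu * X]vE /c; set r := Num.sqrt v => v1 sv.
  by field; rewrite !gt_eqF.
rewrite -ltr_pdivlMl// mulrC -ltr_sqr ?nnegrE ?ltW ?divr_gt0//.
by rewrite sqr_sqrtr// ltW.
Qed.

(** Taking w0 equal to twice the threshold makes the norm a multiple of
    1 / sqrt v0. *)
Lemma L2_norm_initial_small_escape nu e : 0 < nu -> 0 < e -> exists M : R,
    forall v0' : R, 0 < v0' -> M < v0' -> exists w0' : R,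
      nu * (1 + v0') < w0' /\
      (L2_norm ((omega nu v0' w0')^~ 0%R) < e%:E)%E.
Proof.
move=> nu0 e0; have sp : 0 < Num.sqrt (pi : R) by rewrite sqrtr_gt0 pi_gt0.
pose c := 4 * Num.sqrt pi * nu; have c0 : 0 < c by rewrite !mulr_gt0.
exists ((c / e) ^+ 2) => v v_gt0 vd; exists (2 * (nu * (1 + v))).
have v1 : 0 < 1 + v by lra.
have k0 : 0 < nu * (1 + v) by rewrite !mulr_gt0.
split; first by lra.
have sv : 0 < Num.sqrt v by rewrite sqrtr_gt0.
rewrite L2_norm_initial// lte_fin gtr0_norm ?mulr_gt0//.
have -> : 2 * Num.sqrt pi * (2 * (nu * (1 + v))) / (Num.sqrt v * (1 + v)) = c / Num.sqrt v.
  by rewrite /c; field; rewrite !gt_eqF.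
rewrite ltr_pdivrMr// mulrC -ltr_pdivrMr// -ltr_sqr ?nnegrE ?ltW ?divr_gt0//.
by rewrite sqr_sqrtr// ltW.
Qed.

Lemma borderline_norms nu (v0 w0 s k : R) : 0 < nu -> 0 < v0 -> s ^+ 2 = 1 -> 0 < k ->
  (forall t, s * pole nu v0 w0 t = 1 - k * expR (- (nu * t))) ->
  (forall t, `|amplitude nu v0 w0 t| = 2 * nu * k * expR (- (nu * t))) ->
  (forall t, 0 <= t -> `|pole nu v0 w0 t| < 1) ->
  [/\ Linf_norm ((omega nu v0 w0)^~ t) @[t --> +oo] --> nu%:E,
      wiener_norm ((omega nu v0 w0)^~ t) @[t --> +oo] --> (2 * nu)%:E,
      L2_norm ((omega nu v0 w0)^~ t) @[t --> +oo] --> (0 : \bar R) &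
      behaves_like (fun t => fine (L2_norm ((omega nu v0 w0)^~ t)))
                   (fun t => expR (- (nu * t) / 2))].
Proof.
move=> nu0 v00 s2 k0 sp am pb; split.
- exact: borderline_Linf s2 k0 sp am pb.
- exact: borderline_wiener s2 k0 sp am pb.
- exact: borderline_L2 s2 k0 sp am pb.
- exact: borderline_L2_rate s2 k0 sp am pb.
Qed.

End Assembly.
Theorem mainTheorem7 (R : realType) (nu v0 w0 : R)
    (nu_gt0 : 0 < nu) (v0_gt0 : 0 < v0) (w0_neq0 : w0 != 0) :
  let v : R -> R := vc nu v0 w0 in
  let w : R -> R := omega_m1 nu v0 w0 in
  let om : R -> R -> R := omega nu v0 w0 in
  (* exact solution and norms, as long as 0 < v_c < oo *)
  [/\ v 0 = v0, w 0 = w0 &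
    forall T : \bar R,
      (forall t : R, 0 <= t -> (t%:E < T)%E -> vc_pos_finite nu v0 w0 t) ->
      is_solution nu T om /\
      forall t : R, 0 <= t -> (t%:E < T)%E ->
        [/\ forall x : R, complex.Im (omegaC nu v0 w0 x t) = 0,
            Linf_norm (om^~ t) = (`|w t| / v t)%:E,
            L2_norm (om^~ t) =
              (2 * Num.sqrt pi * `|w t| / (Num.sqrt (v t) * (1 + v t)))%:E &
            wiener_norm (om^~ t) =
              (`|w t| / v t * (`|1 - v t| / (1 + v t) + 1))%:E]]
  /\
  (* (a) *)
  (- nu * v0 * (1 + v0) < w0 -> w0 < nu * (1 + v0) ->
    (forall t : R, 0 < t -> vc_pos_finite nu v0 w0 t) /\
    is_solution nu +oo%E om)
  /\
  (* (b1) *)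
  (w0 = - nu * v0 * (1 + v0) ->
    [/\ is_solution nu +oo%E om,
        w t @[t --> +oo] --> (0 : R),
        v t @[t --> +oo] --> (0 : R),
        behaves_like w (fun t => expR (- (nu * t))) &
        behaves_like v (fun t => expR (- (nu * t)))])
  /\
  (* (b2) *)
  (w0 = nu * (1 + v0) ->
    [/\ is_solution nu +oo%E om,
        w t @[t --> +oo] --> +oo,
        v t @[t --> +oo] --> +oo,
        behaves_like w (fun t => expR (nu * t)) &
        behaves_like v (fun t => expR (nu * t))])
  /\
  (* (b1) and (b2) *)
  (w0 = - nu * v0 * (1 + v0) \/ w0 = nu * (1 + v0) ->
    [/\ Linf_norm (om^~ t) @[t --> +oo] --> nu%:E,
        wiener_norm (om^~ t) @[t --> +oo] --> (2 * nu)%:E,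
        L2_norm (om^~ t) @[t --> +oo] --> (0 : \bar R) &
        behaves_like (fun t => fine (L2_norm (om^~ t)))
                     (fun t => expR (- (nu * t) / 2))])
  /\
  (* (c1) *)
  (w0 < - nu * v0 * (1 + v0) ->
    let tc := nu^-1 * ln (w0 / (w0 + nu * v0 * (1 + v0))) in
    [/\ (forall t : R, 0 <= t -> t < tc -> vc_pos_finite nu v0 w0 t) /\
        solution_until nu tc om,
        vc_den nu v0 w0 tc != 0 /\ v tc = 0,
        blowup_points om tc = [set 0],
        Linf_norm (om^~ t) @[t --> tc^'-] --> +oo%E &
        L2_norm (om^~ t) @[t --> tc^'-] --> +oo%E] /\
    [/\ ((nu * (1 + v0))%:E < Linf_norm (om^~ 0%R))%E,
        ((2 * nu * Num.sqrt (pi * v0))%:E < L2_norm (om^~ 0%R))%E,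
        v0 < 1 -> ((2 * nu)%:E < wiener_norm (om^~ 0%R))%E &
        1 <= v0 -> ((2 * nu * v0)%:E < wiener_norm (om^~ 0%R))%E])
  /\
  (* (c1), small initial L2 norm *)
  (forall e : R, 0 < e -> exists d : R, 0 < d /\
    forall v0' : R, 0 < v0' -> v0' < d -> exists w0' : R,
      w0' < - nu * v0' * (1 + v0') /\
      (L2_norm ((omega nu v0' w0')^~ 0%R) < e%:E)%E)
  /\
  (* (c2) *)
  (nu * (1 + v0) < w0 ->
    let tc := nu^-1 * ln (w0 / (w0 - nu * (1 + v0))) in
    [/\ (forall t : R, 0 <= t -> t < tc -> vc_pos_finite nu v0 w0 t) /\
        solution_until nu tc om,
        v t @[t --> tc^'-] --> +oo,
        blowup_points om tc = [set - pi; pi],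
        Linf_norm (om^~ t) @[t --> tc^'-] --> +oo%E &
        L2_norm (om^~ t) @[t --> tc^'-] --> +oo%E] /\
    [/\ ((nu * (1 + v0^-1))%:E < Linf_norm (om^~ 0%R))%E,
        ((2 * nu * Num.sqrt (pi / v0))%:E < L2_norm (om^~ 0%R))%E,
        v0 < 1 -> ((2 * nu / v0)%:E < wiener_norm (om^~ 0%R))%E &
        1 <= v0 -> ((2 * nu)%:E < wiener_norm (om^~ 0%R))%E])
  /\
  (* (c2), small initial L2 norm *)
  (forall e : R, 0 < e -> exists M : R,
    forall v0' : R, 0 < v0' -> M < v0' -> exists w0' : R,
      nu * (1 + v0') < w0' /\
      (L2_norm ((omega nu v0' w0')^~ 0%R) < e%:E)%E).
Proof.
move=> v w om.
have v1 : 0 < 1 + v0 by lra.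
have k1 : 0 < nu * v0 * (1 + v0) by rewrite !mulr_gt0.
have k2 : 0 < nu * (1 + v0) by rewrite mulr_gt0.
split.
  split; [exact: vc_at0|exact: omega_m1_at0|move=> T good].
  have pb t : 0 <= t -> (t%:E < T)%E -> `|pole nu v0 w0 t| < 1.
    by move=> t0 tT; apply/(vc_pos_finiteP _ nu_gt0 v0_gt0); exact: good.
  split; first exact: omega_is_solution.
  move=> t t0 tT; have q1 := pb t t0 tT; split.
  - by move=> x; exact: Im_omegaC.
  - exact: Linf_norm_omega.
  - exact: L2_norm_omega.
  - exact: wiener_norm_omega.
split.
  move=> h1 h2; have h : - nu * v0 * (1 + v0) <= w0 <= nu * (1 + v0) by rewrite !ltW.
  split; last exact: omega_is_solution_bounded.
  move=> t t0; apply/(vc_pos_finiteP _ nu_gt0 v0_gt0).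
  by apply: pole_bounded_all => //; exact: ltW.
split.
  move=> w0E.
  have e0 t : expR (- (nu * t)) != 0 by rewrite gt_eqF// expR_gt0.
  have cw := left_end_w nu_gt0 v0_gt0 w0E; have cv := left_end_v nu_gt0 v0_gt0 w0E.
  have cd := cvg_decay nu_gt0.
  split.
  - exact: omega_is_solution_bounded (left_end_range nu_gt0 v0_gt0 w0E).
  - exact: cvg_of_ratio0 e0 cw cd.
  - exact: cvg_of_ratio0 e0 cv cd.
  - exists (4 * w0 / (1 + v0) ^+ 2 / 2 ^+ 2); split; last exact: cw.
    by rewrite !mulf_neq0 ?invr_eq0 ?expf_neq0// gt_eqF.
  - exists (2 * v0 / (1 + v0) / 2); split; last exact: cv.
    by rewrite gt_eqF// !divr_gt0// mulr_gt0.
split.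
  move=> w0E.
  have e0 t : 0 < expR (nu * t) by rewrite expR_gt0.
  have cw := right_end_w nu_gt0 v0_gt0 w0E; have cv := right_end_v nu_gt0 v0_gt0 w0E.
  have cd : (expR (nu * t))^-1 @[t --> +oo] --> (0 : R).
    by under eq_fun do rewrite -expRN; exact: cvg_decay.
  have w0_gt0 : 0 < w0 by rewrite w0E.
  split.
  - exact: omega_is_solution_bounded (right_end_range nu_gt0 v0_gt0 w0E).
  - exact: cvgy_of_ratio w0_gt0 e0 cw cd.
  - exact: cvgy_of_ratio v1 e0 cv cd.
  - by exists w0.
  - by exists (1 + v0); rewrite gt_eqF.
split.
  case=> w0E.
    apply: (@borderline_norms _ nu v0 w0 1 (2 * v0 / (1 + v0))) => //.
    - by rewrite expr1n.
    - by rewrite divr_gt0// mulr_gt0.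
    - by move=> t; rewrite mul1r; exact: left_end_pole.
    - exact: left_end_amplitude.
    - by move=> t; apply: pole_bounded_all => //; exact: left_end_range.
  apply: (@borderline_norms _ nu v0 w0 (-1) (2 / (1 + v0))) => //.
  - by rewrite sqrrN expr1n.
  - by rewrite divr_gt0.
  - exact: right_end_pole.
  - exact: right_end_amplitude.
  - by move=> t; apply: pole_bounded_all => //; exact: right_end_range.
split.
  move=> w0_lt tc.
  have s2 : (1 : R) ^+ 2 = 1 by rewrite expr1n.
  have tc0 : 0 < tc := collapse_tc_gt0 nu_gt0 v0_gt0 w0_lt.
  have pb t : 0 <= t -> t < tc -> `|pole nu v0 w0 t| < 1 := @collapse_bounded _ _ _ _ nu_gt0
    v0_gt0 w0_neq0 w0_lt t.
  have ptc : pole nu v0 w0 tc = 1 := collapse_pole nu_gt0 v0_gt0 w0_neq0 w0_lt.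
  have bp := blowup_points_0 nu_gt0 v0_gt0 w0_neq0 tc0 pb ptc.
  have wn : nu * v0 * (1 + v0) < `|w0|.
    by rewrite ltr0_norm; move: w0_lt; rewrite !mulNr; lra.
  split; split.
  - split.
      by move=> t t0 t1; apply/(vc_pos_finiteP _ nu_gt0 v0_gt0); exact: pb.
    apply: (omega_solution_until nu_gt0 v0_gt0 tc0 pb (x := 0)).
    by rewrite bp.
  - have p2 : 1 + pole nu v0 w0 tc != 0 by rewrite ptc.
    by rewrite vc_den_eq0// /v vcE// ptc subrr mul0r.
  - exact: bp.
  - by apply: (@blowup_Linf R nu v0 w0 _ _ _ _ tc s2 tc0 pb ptc).
  - by apply: (@blowup_L2 R nu v0 w0 _ _ _ _ tc s2 tc0 pb ptc).
  - by rewrite Linf_norm_initial// lte_fin ltr_pdivlMr// mulrAC.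
  - exact: L2_norm_initial_gt.
  - move=> v01; rewrite wiener_norm_initial_lt1// lte_fin ltr_pdivlMr ?mulr_gt0//; lra.
  - move=> v01; rewrite wiener_norm_initial_ge1// lte_fin ltr_pdivlMr//; lra.
split; first by move=> e e0; exact: L2_norm_initial_small_collapse.
split; last by move=> e e0; exact: L2_norm_initial_small_escape.
move=> w0_gt tc.
have s2 : (-1 : R) ^+ 2 = 1 by rewrite sqrrN expr1n.
have tc0 : 0 < tc := escape_tc_gt0 nu_gt0 v0_gt0 w0_gt.
have pb t : 0 <= t -> t < tc -> `|pole nu v0 w0 t| < 1 := @escape_bounded _ _ _ _ nu_gt0 v0_gt0
  w0_neq0 w0_gt t.
have ptc : pole nu v0 w0 tc = -1 := escape_pole nu_gt0 v0_gt0 w0_neq0 w0_gt.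
have bp := blowup_points_pi nu_gt0 v0_gt0 w0_neq0 tc0 pb ptc.
have wn : nu * (1 + v0) < `|w0| by rewrite gtr0_norm; lra.
split; split.
- split.
    by move=> t t0 t1; apply/(vc_pos_finiteP _ nu_gt0 v0_gt0); exact: pb.
  apply: (omega_solution_until nu_gt0 v0_gt0 tc0 pb (x := pi)).
  by rewrite bp; right.
- exact: escape_vc_cvg.
- exact: bp.
- by apply: (@blowup_Linf R nu v0 w0 _ _ _ _ tc s2 tc0 pb ptc).
- by apply: (@blowup_L2 R nu v0 w0 _ _ _ _ tc s2 tc0 pb ptc).
- rewrite Linf_norm_initial// lte_fin ltr_pdivlMr//.
  by rewrite -mulrA mulrDl mul1r mulVf ?gt_eqF// addrC.
- exact: L2_norm_initial_gt_inv.
- move=> v01; rewrite wiener_norm_initial_lt1// lte_fin ltr_pdivlMr ?mulr_gt0//.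
  have -> : 2 * nu / v0 * (v0 * (1 + v0)) = 2 * (nu * (1 + v0)) by field; rewrite gt_eqF.
  by rewrite ltr_pM2l.
- move=> v01; rewrite wiener_norm_initial_ge1// lte_fin ltr_pdivlMr//; lra.
Qed.
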